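(* Let $G=(V,E)$ be a tree. The following algorithm runs in time $O(n\cdot|E|)$ and outputs a minimum-size set power dominating $G$: root $G$ at a node $r$, let $d$ be the maximum distance from $r$; set $S=\emptyset$; for $\ell=d,d-1,\dots,0$ and for each node $v$ at distance $\ell$ from $r$, let $Y_v$ be the set of nodes of the subtree rooted at $v$; if $Y_v$ is an $S$-strong region (for the current $S$), set $S\leftarrow S\cup\{v\}$; output $S$.
   Context: For an undirected graph $G=(V,E)$ with $n$ nodes and $S\subseteq V$, $\mathcal{P}_S$ is obtained by (Rule 1) putting every node of $S$ and every neighbor of a node of $S$ into $\mathcal{P}_S$, and (Rule 2) repeatedly: if $v\in\mathcal{P}_S$ and all neighbors of $v$ except exactly one neighbor $w$ are in $\mathcal{P}_S$, insert $w$. $S$ power dominates $G$ if $\mathcal{P}_S=V$. For $R\subseteq V$, $nbr(R)=\{v\in V\setminus R: v$ adjacent to some $u\in R\}$; $R$ is an $S$-strong region if $R\not\subseteq\mathcal{P}_{S\cup nbr(R)}$. *)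

(* Defs.v *)
From mathcomp Require Import all_boot.

Set Implicit Arguments.
Unset Strict Implicit.
Unset Printing Implicit Defensive.

Section PowerDomination.
Variables (T : finType) (e : rel T).

Definition simple_graph := symmetric e /\ irreflexive e.

(* With e symmetric, [:: x; y] is an e-cycle for every edge xy, so only the
   duplicate-free e-cycles with at least three nodes are graph cycles. *)
Definition is_tree :=
  [/\ simple_graph, forall x y, connect e x y
    & forall c : seq T, ucycle e c -> size c <= 2].

Definition edges : {set {set T}} :=
  [set D : {set T} | [exists x, exists y, e x y && (D == [set x; y])]].

Definition rule1 (S : {set T}) : {set T} :=
  S :|: [set w | [exists v in S, e v w]].

Definition forces (P : {set T}) (v w : T) : bool :=
  [&& v \in P, e v w, w \notin P & [forall u, e v u && (u != w) ==> (u \in P)]].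

Definition rule2 (P : {set T}) : {set T} :=
  P :|: [set w | [exists v, forces P v w]].

(* #|T| rounds suffice, as every round that changes the set adds a node;
   inserting all forced nodes of a round at once instead of one by one does not
   change the outcome, see power_closureP. *)
Definition power_closure (S : {set T}) : {set T} := iter #|T| rule2 (rule1 S).

Inductive observed (S : {set T}) : T -> Prop :=
| ObsIn v : v \in S -> observed S v
| ObsNbr v w : v \in S -> e v w -> observed S w
| ObsForce v w : observed S v -> e v w ->
    (forall u, e v u -> u != w -> observed S u) -> observed S w.

Definition power_dominates (S : {set T}) : bool := power_closure S == setT.

Definition minimum_power_dominating (S : {set T}) : Prop :=
  power_dominates S /\ forall S', power_dominates S' -> #|S| <= #|S'|.

Definition nbr (A : {set T}) : {set T} :=
  [set v | (v \notin A) && [exists u in A, e u v]].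

Definition strong_region (S A : {set T}) : bool :=
  ~~ (A \subset power_closure (S :|: nbr A)).

(* The default #|T| is taken exactly when y is not reachable from x. *)
Definition dist (x y : T) : nat :=
  find (fun k => [exists p : k.-tuple T, path e x p && (last x p == y)])
       (iota 0 #|T|).

Definition child (r : T) : rel T :=
  [rel x y | e x y && (dist r y == (dist r x).+1)].

Definition subtree (r v : T) : {set T} := [set u | connect (child r) v u].

(* The enumerations of the nodes level by level, from the deepest level up to r,
   in any order inside a level. *)
Definition level_order (r : T) (s : seq T) : bool :=
  perm_eq s (enum T) && sorted [rel x y | dist r y <= dist r x] s.

Definition greedy_step (r : T) (S : {set T}) (v : T) : {set T} :=
  if strong_region S (subtree r v) then v |: S else S.

Definition greedy (r : T) (s : seq T) : {set T} :=
  foldl (greedy_step r) set0 s.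

Lemma rule2_sub (P : {set T}) : P \subset rule2 P.
Proof. exact: subsetUl. Qed.

Lemma rule2_stable S : rule2 (power_closure S) = power_closure S.
Proof.
have grow k : (k <= #|iter k rule2 (rule1 S)|) ||
    (rule2 (iter k rule2 (rule1 S)) == iter k rule2 (rule1 S)).
  elim: k => [//|k /orP[le_k|/eqP fix_k]]; last first.
    by rewrite iterS !fix_k eqxx orbT.
  rewrite iterS; set P := iter k _ _ in le_k *.
  have [eqP|neqP] := eqVneq (rule2 P) P; first by rewrite !eqP eqxx orbT.
  apply/orP; left; apply: leq_ltn_trans le_k (proper_card _).
  by rewrite properEneq eq_sym neqP rule2_sub.
rewrite /power_closure; case/orP: (grow #|T|) => [le_T|/eqP //].
have -> : iter #|T| rule2 (rule1 S) = setT.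
  by apply/eqP; rewrite eqEcard subsetT cardsT.
by apply/eqP; rewrite eqEsubset subsetT rule2_sub.
Qed.

Lemma power_closureP S x : reflect (observed S x) (x \in power_closure S).
Proof.
apply: (iffP idP).
  rewrite /power_closure; elim: #|T| x => [|k IHk] x /=.
    by rewrite !inE => /orP[/ObsIn//|/existsP[v /andP[vS evx]]]; apply: ObsNbr evx.
  rewrite !inE => /orP[/IHk//|/existsP[v /and4P[/IHk ov evx _ /forallP fv]]].
  apply: ObsForce ov evx _ => u evu neq; apply: IHk.
  by move/implyP: (fv u); apply; rewrite evu.
have sub1 : rule1 S \subset power_closure S.
  rewrite /power_closure; elim: #|T| => [//|k IHk] /=.
  exact: subset_trans IHk (rule2_sub _).
elim=> {x} [v vS|v w vS evw|v w _ vP evw _ IHu].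
- by apply: (subsetP sub1); rewrite !inE vS.
- by apply: (subsetP sub1);
  rewrite !inE; apply/orP; right; apply/existsP; exists v; rewrite vS.
apply: contraT => wP; suff: w \in rule2 (power_closure S).
  by rewrite rule2_stable (negPf wP).
rewrite !inE; apply/orP; right; apply/existsP; exists v.
rewrite /forces vP evw wP; apply/forallP => u; apply/implyP => /andP[evu neq].
exact: IHu.
Qed.

End PowerDomination.

(* Random access machine with a fixed finite set of arrays of natural numbers.
   A scalar variable is an array used at index 0 only. The numbers computed
   by the program below exceed the largest number of its input by at most one,
   so that charging one step per operation is the usual unit-cost measure. *)

Inductive name :=
| N | ROOT | OFF | TGT                      (* input *)
| OUT                                       (* output *)
| ORD | PAR | SEEN | Y | DOM | P | CNT | QUEUE      (* work arrays *)
| I | J | K | L | U | V | W | X | HD | TL | BAD.    (* work scalars *)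

Scheme Equality for name.

Inductive exp :=
| Num of nat
| Get of name & exp
| Add of exp & exp
| Sub of exp & exp
| Eq of exp & exp
| Lt of exp & exp.

Inductive cmd :=
| Skip
| Put of name & exp & exp
| Seq of cmd & cmd
| If of exp & cmd & cmd
| While of exp & cmd.

Definition store := name -> nat -> nat.

Fixpoint eval (s : store) (x : exp) : nat :=
  match x with
  | Num k => k
  | Get a i => s a (eval s i)
  | Add x1 x2 => eval s x1 + eval s x2
  | Sub x1 x2 => eval s x1 - eval s x2
  | Eq x1 x2 => eval s x1 == eval s x2
  | Lt x1 x2 => eval s x1 < eval s x2
  end.

Fixpoint exp_cost (x : exp) : nat :=
  match x with
  | Num _ => 1
  | Get _ i => (exp_cost i).+1
  | Add x1 x2 | Sub x1 x2 | Eq x1 x2 | Lt x1 x2 =>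
      (exp_cost x1 + exp_cost x2).+1
  end.

Definition update (s : store) (a : name) (i k : nat) : store :=
  fun b j => if name_beq b a && (j == i) then k else s b j.

(* exec c s s' t: started in s, the command c halts in s' after t elementary
   steps, where every literal, array access, arithmetic operation, comparison,
   assignment and branch is one step. *)
Inductive exec : cmd -> store -> store -> nat -> Prop :=
| ExecSkip s : exec Skip s s 1
| ExecPut a i x s :
    exec (Put a i x) s (update s a (eval s i) (eval s x))
         (exp_cost i + exp_cost x).+1
| ExecSeq c1 c2 s s1 s2 t1 t2 : exec c1 s s1 t1 -> exec c2 s1 s2 t2 ->
    exec (Seq c1 c2) s s2 (t1 + t2)
| ExecIfT x c1 c2 s s1 t : eval s x != 0 -> exec c1 s s1 t ->
    exec (If x c1 c2) s s1 (exp_cost x + t).+1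
| ExecIfF x c1 c2 s s1 t : eval s x = 0 -> exec c2 s s1 t ->
    exec (If x c1 c2) s s1 (exp_cost x + t).+1
| ExecWhileT x c s s1 s2 t1 t2 : eval s x != 0 ->
    exec c s s1 t1 -> exec (While x c) s1 s2 t2 ->
    exec (While x c) s s2 (exp_cost x + t1 + t2).+1
| ExecWhileF x c s : eval s x = 0 -> exec (While x c) s s (exp_cost x).+1.

Lemma exec_det c s s1 t1 s2 t2 :
  exec c s s1 t1 -> exec c s s2 t2 -> s1 = s2 /\ t1 = t2.
Proof.
move=> ex1; elim: ex1 s2 t2 => {c s s1 t1}; intros;
  match goal with ex2 : exec _ _ ?s ?t |- _ = ?s /\ _ = ?t =>
    inversion ex2; subst end;
  repeat match goal with
  | IH : (forall s' t', exec ?c ?s s' t' -> ?s0 = s' /\ ?t0 = t'),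
    ex : exec ?c ?s ?s' _ |- _ => tryif constr_eq s0 s' then fail else
      case: (IH _ _ ex) => ? ?; clear IH; subst
  | z : eval ?s ?x = 0, nz : is_true (eval ?s ?x != 0) |- _ =>
      by rewrite z in nz
  end; by [].
Qed.

Notation "c1 ;; c2" := (Seq c1 c2)
  (at level 90, right associativity, only parsing).
Notation "$ x" := (Get x (Num 0)) (at level 2, only parsing).
Notation "a @[ i ]" := (Get a i) (at level 2, only parsing).
Notation "x <~ v" := (Put x (Num 0) v)
  (at level 80, v at level 79, only parsing).

Definition incr (x : name) : cmd := x <~ Add $x (Num 1).

Definition for_range (i : name) (lo hi : exp) (body : cmd) : cmd :=
  i <~ lo ;; While (Lt $i hi) (body ;; incr i).

(* The neighbours of the node u are TGT[OFF[u]], ..., TGT[OFF[u+1] - 1]. *)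
Definition for_nbr (i w u : name) (body : cmd) : cmd :=
  for_range i OFF@[$u] OFF@[Add $u (Num 1)] (w <~ TGT@[$i] ;; body).

(* Breadth-first search from the root: ORD lists the nodes by nondecreasing
   distance and PAR holds the parents (the root is its own parent). *)
Definition bfs : cmd :=
  for_range I (Num 0) $N (Put SEEN $I (Num 0)) ;;
  Put ORD (Num 0) $ROOT ;;
  Put SEEN $ROOT (Num 1) ;;
  Put PAR $ROOT $ROOT ;;
  HD <~ Num 0 ;;
  TL <~ Num 1 ;;
  While (Lt $HD $TL)
    (U <~ ORD@[$HD] ;;
     incr HD ;;
     for_nbr K W U
       (If SEEN@[$W] Skip
          (Put SEEN $W (Num 1) ;;
           Put PAR $W $U ;;
           Put ORD $TL $W ;;
           incr TL))).

(* Y := the nodes of the subtree rooted at V. *)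
Definition compute_subtree : cmd :=
  for_range I (Num 0) $N (Put Y $I (Num 0)) ;;
  Put Y $V (Num 1) ;;
  for_range I (Num 0) $N
    (U <~ ORD@[$I] ;; If Y@[PAR@[$U]] (Put Y $U (Num 1)) Skip).

(* DOM := OUT together with nbr(Y). *)
Definition compute_dom : cmd :=
  for_range I (Num 0) $N (Put DOM $I OUT@[$I]) ;;
  for_range U (Num 0) $N
    (If Y@[$U]
       (for_nbr K W U (If Y@[$W] Skip (Put DOM $W (Num 1))))
       Skip).

Definition insert (x : name) : cmd :=
  If P@[$x] Skip
    (Put P $x (Num 1) ;;
     Put QUEUE $TL $x ;;
     incr TL).

(* CNT[x] is the number of neighbours of x that have left the queue; if it is
   deg(x) - 1, at most one neighbour of x is missing from P. *)
Definition propagate (x : name) : cmd :=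
  If (Eq (Add OFF@[$x] (Add CNT@[$x] (Num 1))) OFF@[Add $x (Num 1)])
     (for_nbr L X x (insert X)) Skip.

(* P := the set of nodes obtained from DOM by the two rules. *)
Definition compute_power_closure : cmd :=
  for_range I (Num 0) $N (Put P $I (Num 0) ;; Put CNT $I (Num 0)) ;;
  HD <~ Num 0 ;;
  TL <~ Num 0 ;;
  for_range U (Num 0) $N
    (If DOM@[$U] (insert U ;; for_nbr K W U (insert W)) Skip) ;;
  While (Lt $HD $TL)
    (U <~ QUEUE@[$HD] ;;
     incr HD ;;
     propagate U ;;
     for_nbr K W U
       (Put CNT $W (Add CNT@[$W] (Num 1)) ;;
        If P@[$W] (propagate W) Skip)).

(* BAD := 1 if Y is not contained in P, and 0 otherwise. *)
Definition test_strong : cmd :=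
  BAD <~ Num 0 ;;
  for_range U (Num 0) $N
    (If Y@[$U] (If P@[$U] Skip (BAD <~ Num 1)) Skip).

Definition greedy_program : cmd :=
  for_range I (Num 0) $N (Put OUT $I (Num 0)) ;;
  bfs ;;
  J <~ $N ;;
  While (Lt (Num 0) $J)
    (J <~ Sub $J (Num 1) ;;
     V <~ ORD@[$J] ;;
     compute_subtree ;;
     compute_dom ;;
     compute_power_closure ;;
     test_strong ;;
     If $BAD (Put OUT $V (Num 1)) Skip).

(* The store s holds the adjacency lists of the graph and the root, the nodes
   being numbered 0, ..., #|T| - 1 by num; nothing is assumed about the
   remaining cells, nor about the order inside an adjacency list. *)
Definition encodes (T : finType) (e : rel T) (r : T) (num : T -> nat)
    (s : store) : Prop :=
  [/\ injective num /\ (forall x, num x < #|T|),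
      s N 0 = #|T|,
      s ROOT 0 = num r
    & forall x, perm_eq
        [seq s TGT k | k <- index_iota (s OFF (num x)) (s OFF (num x).+1)]
        [seq num y | y <- enum (e x)]].

Definition output (T : finType) (num : T -> nat) (s : store) : {set T} :=
  [set x | s OUT (num x) != 0].

(* Main.v *)
(* Minimality is an exchange argument. Once v is processed, every node of Y_v is
   observed from S and nbr(Y_v). A power dominating set S' containing the current S
   must meet an S-strong region Y_v in some w outside S, because nothing outside
   Y_v helps inside beyond nbr(Y_v); and swapping w for v keeps S' power dominating,
   because the only edge leaving Y_v is at v and the subtrees of the children of v
   are already settled. So some minimum solution always contains S.

   The program is verified with time credits. In the computation of P_S a node is
   expensive to propagate only when it leaves the queue, or when the count of its
   dequeued neighbours reaches deg - 1, so the degrees pay for one closure, and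
   n <= sum of degrees <= 2|E| turns n closures into O(n|E|). *)
From mathcomp Require Import all_boot zify.
Require Import Defs.

Set Implicit Arguments.
Unset Strict Implicit.
Unset Printing Implicit Defensive.

(** * Power domination in trees *)

(** Acyclicity enters only through [path_avoid_unique]: two neighbours of [x] that are no deeper
    than [x] must coincide. Unique parents, the absence of edges inside a level and the single exit
    of a subtree all follow from this.

    Minimality is stated against every power dominating set rather than against one chosen optimum,
    so each exchange can start from whatever set the previous exchange returned.

    In the program the obstacle is the cost of Rule 2. [CNT] counts the neighbours that have left
    the queue, not those in [P]: each adjacency then raises one counter exactly once, which bounds
    the work. A forcing may be noticed late, but it is not lost, because both counts agree when the
    queue is empty, and only then is completeness claimed.

    Specifications of program parts are two-sided: enough credits going in, and a bound on the
    credits spent coming out. Consecutive parts then compose by linear arithmetic. The numerical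
    constants are rounded up. *)

Section Observation.
Variables (T : finType) (e : rel T).
Implicit Types (S A : {set T}) (x y v w : T).

Lemma observed_sub S S' x : S \subset S' -> observed e S x -> observed e S' x.
Proof.
move=> sub; elim=> {x} [v vS|v w vS evw|v w _ ov evw _ IH].
- exact/ObsIn/(subsetP sub).
- exact: ObsNbr (subsetP sub _ vS) evw.
- exact: ObsForce ov evw IH.
Qed.

Lemma power_dominatesP S : reflect (forall x, observed e S x) (power_dominates e S).
Proof.
apply: (iffP eqP) => [eqT x|obs]; first by apply/power_closureP; rewrite eqT inE.
by apply/setP => x; rewrite inE; apply/power_closureP.
Qed.

Lemma strong_regionPn S A :
  reflect {in A, forall x, observed e (S :|: nbr e A) x} (~~ strong_region e S A).
Proof.
rewrite negbK; apply: (iffP subsetP) => sub x /sub; first by move/power_closureP.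
by move=> ox; apply/power_closureP.
Qed.

(* Nothing outside A can help inside A beyond what nbr A already provides. *)
Lemma strong_region_meets S A S' :
  symmetric e -> strong_region e S A -> power_dominates e S' ->
  exists2 w, w \in A & w \in S' :\: S.
Proof.
move=> sym_e str /power_dominatesP dom.
have [/exists_inP[w wA wS]|/exists_inPn none] :=
  boolP [exists w in A, w \in S' :\: S]; first by exists w.
case/strong_regionPn: str => x xA.
have inS v : v \in A -> v \in S' -> v \in S.
  by move=> vA vS'; have := none v vA; rewrite inE vS' andbT negbK.
have outA v w : w \in A -> e v w -> v \in A \/ v \in S :|: nbr e A.
  move=> wA evw; have [|vA] := boolP (v \in A); [by left | right].
  by rewrite !inE vA; apply/orP/or_intror/exists_inP; exists w; rewrite // sym_e.
(* The derivation from [S'] is replayed inside [A]: a node outside [A] that it uses is adjacent to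
   [A], hence in [nbr e A], and is available as a source. *)
elim: (dom x) xA => {x} [v vS' vA|v w vS' evw wA|v w _ IHv evw _ IHu wA].
- by apply: ObsIn; rewrite inE inS.
- have [vA|vN] := outA v w wA evw; last exact: ObsNbr vN evw.
  by apply: (ObsNbr (v := v)) => //; rewrite inE inS.
have [vA|vN] := outA v w wA evw; last exact: ObsNbr vN evw.
apply: (ObsForce (v := v)) => // [|u evu neq]; first exact: IHv.
have [uA|uN] := boolP (u \in A); first exact: IHu.
by apply: ObsIn; rewrite !inE uN; apply/orP/or_intror/exists_inP; exists v.
Qed.

End Observation.

(** * Distances, parents and subtrees in a rooted tree *)

Section Tree.
Variables (T : finType) (e : rel T) (r : T).
Hypothesis tree : is_tree e.
Implicit Types (S A : {set T}) (x y u v w : T).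

Local Notation dist := (dist e r).
Local Notation child := (child e r).
Local Notation subtree := (subtree e r).

Lemma tree_sym : symmetric e. Proof. by case: tree => -[]. Qed.
Lemma tree_irr : irreflexive e. Proof. by case: tree => -[]. Qed.

(** A duplicate-free path has fewer than [#|T|] edges, so the search in [dist] succeeds and its
    default value is never returned. *)
Lemma dist_path y :
  exists p, [/\ path e r p, last r p = y, size p = dist y & dist y < #|T|].
Proof.
have [_ /(_ r y)/connectP[p0 e_p0 ->] _] := tree.
case/shortenP: e_p0 => p e_p uniq_p _.
have lt_p : size p < #|T| by have := max_card (mem (r :: p)); rewrite (card_uniqP uniq_p).
pose q k := [exists t : k.-tuple T, path e r t && (last r t == last r p)].
have has_q : has q (iota 0 #|T|).
  apply/hasP; exists (size p); first by rewrite mem_iota.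
  by apply/existsP; exists (in_tuple p); rewrite e_p eqxx.
have lt_d : dist (last r p) < #|T| by rewrite -[X in _ < X](size_iota 0) -has_find.
have := nth_find 0 has_q; rewrite -/(dist _) nth_iota // add0n.
by case/existsP=> t /andP[e_t /eqP last_t]; exists t; rewrite size_tuple.
Qed.

Lemma dist_le_size p : path e r p -> dist (last r p) <= size p.
Proof.
move=> e_p; rewrite leqNgt; apply/negP => lt_p.
have [_ [_ _ _ lt_d]] := dist_path (last r p).
have := before_find 0 lt_p; rewrite nth_iota ?add0n; last exact: ltn_trans lt_d.
by move/negbT/existsP; case; exists (in_tuple p); rewrite e_p eqxx.
Qed.

Lemma dist_root : dist r = 0.
Proof. by apply/eqP; rewrite -leqn0 (@dist_le_size [::]). Qed.

Lemma dist_edge x y : e x y -> dist y <= (dist x).+1.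
Proof.
move=> exy; have [p [e_p lp sp _]] := dist_path x.
rewrite -sp -(size_rcons p y) -{1}(last_rcons r p y).
by apply: dist_le_size; rewrite rcons_path e_p lp.
Qed.

(** The last node but one of a shortest path from [r] is a parent. *)
Lemma exists_parent x : x != r -> exists y, child y x.
Proof.
have [p [e_p lp sp _]] := dist_path x.
case: (lastP p) => [|q z] in e_p lp sp *; first by rewrite -lp eqxx.
move: e_p lp sp; rewrite rcons_path last_rcons size_rcons => /andP[e_q e_z] <- sp _.
exists (last r q); rewrite /Defs.child /= e_z /=.
have := dist_edge e_z; have := dist_le_size e_q; rewrite -sp; lia.
Qed.

Lemma dist_eq0 x : (dist x == 0) = (x == r).
Proof.
apply/idP/eqP => [|->]; last by rewrite dist_root.
by have [//|/exists_parent[y /andP[_ /eqP->]]] := eqVneq x r.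
Qed.

Lemma child_edge x y : child x y -> e x y. Proof. by case/andP. Qed.

Lemma child_dist x y : child x y -> dist y = (dist x).+1.
Proof. by case/andP=> _ /eqP. Qed.

(** Otherwise a duplicate-free path from [y] to [z] avoiding [x] would close through [x] to a cycle
    with at least three nodes. *)
Lemma path_avoid_unique x y z :
  e x y -> e x z ->
  connect [rel u v | [&& e u v, u != x & v != x]] y z -> y = z.
Proof.
move=> exy exz /connectP[p0 e_p0 def_z].
have [->|neq_yz] := eqVneq y z; first by [].
case: tree => -[sym_e irr_e] _ acyc; move: neq_yz exz; rewrite def_z.
case/shortenP: e_p0 => p e_p uniq_p _ neq exz.
have x_p : x \notin y :: p.
  have y_x : y != x by apply: contraTneq exy => ->; rewrite irr_e.
  rewrite inE eq_sym negb_or y_x /=; move: e_p; clear -irr_e.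
  by elim: p y => //= a p IH y /andP[/and3P[_ _ ax] /IH]; rewrite inE negb_or eq_sym ax.
have : ucycle e (x :: y :: p) -> size p = 0 by move/acyc; case: (p).
rewrite /ucycle [cycle _ _]/= [uniq _]/= -/(uniq (y :: p)).
have -> : path e y (rcons p x).
  rewrite rcons_path sym_e exz andbT.
  by apply: sub_path e_p => a b /= /andP[].
rewrite exy x_p uniq_p => /(_ isT)/size0nil nil_p.
by move: neq; rewrite nil_p eqxx.
Qed.

(** Climb from [u] to the root along parents: after one step the distance is below that of [x], so
    the walk never meets [x]. *)
Lemma connect_root_avoid x u : x != r -> u != x -> dist u <= dist x ->
  connect [rel u v | [&& e u v, u != x & v != x]] u r.
Proof.
move=> x_r; have [n] := ubnP (dist u).
elim: n u => // n IH u le_n u_x le_x.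
have [->//|/exists_parent[v vu]] := eqVneq u r.
have := child_dist vu => def_u.
have v_x : v != x by apply/eqP => def_v; move: le_x; rewrite def_u def_v ltnn.
apply: connect_trans (connect1 _) (IH v _ _ _) => //=; try by move: le_x; lia.
by rewrite tree_sym child_edge // u_x.
Qed.

(** Both neighbours climb to [r] without meeting [x], so they are joined off [x]. The weak
    inequalities matter: [edge_child] applies this to a neighbour on the level of [x]. *)
Lemma edge_eq x y z : x != r -> e x y -> e x z ->
  dist y <= dist x -> dist z <= dist x -> y = z.
Proof.
move=> x_r exy exz le_y le_z; apply: (path_avoid_unique exy exz).
have neq w : e x w -> w != x by apply: contraTneq => ->; rewrite tree_irr.
apply: (@connect_trans _ _ r); first by apply: connect_root_avoid => //; apply: neq.
rewrite sym_connect_sym; first by apply: connect_root_avoid => //; apply: neq.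
by move=> a b /=; rewrite tree_sym [(a != x) && _]andbC.
Qed.

Lemma parent_unique x y z : child y x -> child z x -> y = z.
Proof.
move=> yx zx; apply: (@edge_eq x).
- by rewrite -dist_eq0 (child_dist yx).
- by rewrite tree_sym child_edge.
- by rewrite tree_sym child_edge.
- by rewrite (child_dist yx).
- by rewrite (child_dist zx).
Qed.

(** Distances along an edge differ by at most one. If they were equal, [y] and a parent of [x] would
    be two neighbours no deeper than [x], hence equal, although their levels differ. *)
Lemma edge_child x y : e x y -> child x y || child y x.
Proof.
move=> exy; have eyx : e y x by rewrite tree_sym.
have := dist_edge exy; have := dist_edge eyx; rewrite /Defs.child /= exy eyx /=.
have [eqd _ _|] := eqVneq (dist x) (dist y); last by lia.
have x_r : x != r.
  apply: contraTneq exy => def_x; move/esym: eqd; rewrite def_x dist_root.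
  by move/eqP; rewrite dist_eq0 => /eqP->; rewrite tree_irr.
have [z zx] := exists_parent x_r; have ezx := child_edge zx.
have def_y : y = z.
  apply: (@edge_eq x) => //; rewrite ?(child_dist zx) ?eqd //; first by rewrite tree_sym.
  by rewrite -eqd (child_dist zx).
by have := child_dist zx; rewrite -def_y; lia.
Qed.

Lemma subtree_dist u v : u \in subtree v -> dist v <= dist u.
Proof.
rewrite inE => /connectP[p ch_p ->]; elim: p v ch_p => //= w p IH v /andP[vw /IH].
by rewrite (child_dist vw); apply: ltnW.
Qed.

Lemma subtree_refl v : v \in subtree v. Proof. by rewrite inE connect0. Qed.

Lemma subtree_step v u w : u \in subtree v -> child u w -> w \in subtree v.
Proof. by rewrite !inE => vu /connect1; apply: connect_trans. Qed.

Lemma subtree_split v u : u \in subtree v -> u = v \/ exists2 c, child v c & u \in subtree c.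
Proof.
rewrite inE => /connectP[[|c p] /= ch_p ->]; [by left | right].
by case/andP: ch_p => vc ch_p; exists c => //; rewrite inE; apply/connectP; exists p.
Qed.

Lemma subtree_root u : u \in subtree r.
Proof.
have [n] := ubnP (dist u); elim: n u => // n IH u le_n.
have [->|/exists_parent[v vu]] := eqVneq u r; first exact: subtree_refl.
by apply: (subtree_step _ vu); apply: IH; move: le_n; rewrite (child_dist vu).
Qed.

Lemma subtree_parent v u w : child w u -> (u \in subtree v) = (u == v) || (w \in subtree v).
Proof.
move=> wu; apply/idP/orP => [|[/eqP->|wv]]; last 2 first.
- exact: subtree_refl.
- exact: subtree_step wu.
rewrite !inE => /connectP[p]; case/lastP: p => [_ ->|p z]; first by left.
rewrite rcons_path last_rcons => /andP[ch_p ch_z] def_u; right.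
rewrite -def_u in ch_z; rewrite (parent_unique wu ch_z); apply/connectP; by exists p.
Qed.

Lemma subtree_exit v x y : x \in subtree v -> e x y -> y \notin subtree v ->
  x = v /\ child y v.
Proof.
move=> xv exy; case/orP: (edge_child exy) => [xy|yx]; first by rewrite (subtree_step xv xy).
rewrite (subtree_parent v yx) in xv.
by case/orP: xv => [/eqP<-|->].
Qed.

Lemma nbr_subtree_child v c : child v c -> nbr e (subtree c) \subset [set v].
Proof.
move=> vc; apply/subsetP => y; rewrite /nbr in_set => /andP[yN /exists_inP[x xY exy]].
have [_ yc] := subtree_exit xY exy yN.
by rewrite inE (parent_unique yc vc).
Qed.

(** * The exchange argument along the level order *)

Section Level.
Variable s : seq T.
Hypothesis level_s : level_order e r s.

Lemma level_child a v b c : s = a ++ v :: b -> child v c -> c \in a.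
Proof.
move=> def_s vc; have: c \in s.
  by case/andP: level_s => /perm_mem->; rewrite mem_enum.
have: sorted [rel x y | dist y <= dist x] s by case/andP: level_s.
rewrite def_s mem_cat => sort_s /orP[//|]; rewrite inE => /predU1P[eq_c|cb].
  by have := child_dist vc; rewrite eq_c; lia.
have: sorted [rel x y | dist y <= dist x] (v :: b).
  by apply: (subseq_sorted _ (suffix_subseq a _) sort_s) => x y z /= *; apply: leq_trans; eauto.
rewrite /= path_sortedE; last by move=> x y z /= h1 h2; apply: leq_trans h2 h1.
by case/andP=> /allP/(_ _ cb) /=; rewrite (child_dist vc) ltnn.
Qed.

(** By [strong_regionPn] this is the failure of [strong_region]. It survives enlarging [S], so a
    processed node stays settled. *)
Definition settled S v :=
  {in subtree v, forall u, observed e (S :|: nbr e (subtree v)) u}.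

Lemma settled_sub S S' v : S \subset S' -> settled S v -> settled S' v.
Proof. by move=> sub set_v u /set_v; apply/observed_sub/setSU. Qed.

(** The subtree of a child [c] borders only on [v], which is now in [S]; so no help from outside
    remains in the conclusion. *)
Lemma settled_children S v : v \in S -> (forall c, child v c -> settled S c) ->
  {in subtree v, forall u, observed e S u}.
Proof.
move=> vS set_c u /subtree_split[->|[c vc uc]]; first exact: ObsIn.
apply: observed_sub (set_c c vc u uc); rewrite subUset subxx /=.
by apply: subset_trans (nbr_subtree_child vc) _; rewrite sub1set.
Qed.

Lemma exchange S S' v : S \subset S' -> power_dominates e S' ->
  strong_region e S (subtree v) -> (forall c, child v c -> settled (v |: S) c) ->
  exists S'', [/\ v |: S \subset S'', power_dominates e S'' & #|S''| <= #|S'|].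
Proof.
move=> subS dom str set_c.
have [w wY /setDP[wS' wS]] := strong_region_meets tree_sym str dom.
pose S'' := v |: S' :\ w; exists S''.
have sub : v |: S \subset S''.
  apply: setUS; apply/subsetP => x xS; rewrite !inE (subsetP subS) // andbT.
  by apply: contraNneq wS => <-.
have obsY u : u \in subtree v -> observed e S'' u.
  move=> uY; apply: observed_sub sub _; apply: settled_children uY => //.
  by rewrite setU11.
split=> //; last first.
  rewrite [X in _ <= X](cardsD1 w) wS' add1n /S'' cardsU1.
  by case: (v \notin _); rewrite ?add1n ?add0n.
apply/power_dominatesP => x; move/power_dominatesP: dom => /(_ x).
elim=> {x} [x xS|x y xS exy|x y _ ox exy _ IH]; last exact: ObsForce ox exy IH.
  have [->|x_w] := eqVneq x w; first exact: obsY.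
  by apply: ObsIn; rewrite !inE x_w xS orbT.
(* The removed [w] was a source for its neighbours. Those in the subtree are observed anyway; one
   outside forces [w = v], and [v] is still a source. *)
have [def_x|x_w] := eqVneq x w; last first.
  by apply: (ObsNbr (v := x)) => //; rewrite !inE x_w xS orbT.
have [yY|yN] := boolP (y \in subtree v); first exact: obsY.
have [def_v _] : x = v /\ child y v by apply: subtree_exit yN => //; rewrite def_x.
by apply: (ObsNbr (v := x)) => //; rewrite def_v setU11.
Qed.

Lemma greedy_invariant a b : s = a ++ b ->
  let S := greedy e r a in
  {in a, forall v, settled S v} /\
  forall S', power_dominates e S' ->
    exists S'', [/\ S \subset S'', power_dominates e S'' & #|S''| <= #|S'|].
Proof.
elim/last_ind: a b => [|a v IH] b def_s.
  by split=> // S' dom; exists S'; split; rewrite ?sub0set.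
rewrite cat_rcons in def_s; have [set_a ex] := IH _ def_s.
rewrite /greedy foldl_rcons -/(greedy e r a); move: set_a ex.
set S := greedy e r a => set_a ex.
have set_c c : child v c -> settled S c by move=> /(level_child def_s)/set_a.
(* If the test fails, its failure is exactly [settled S v]; if it succeeds, adding [v] settles its
   subtree through the children, which come earlier in the order. *)
rewrite /greedy_step; case: ifP => [str|/negbT/strong_regionPn nstr]; last first.
  by split=> // u; rewrite mem_rcons inE => /predU1P[->|/set_a].
have set_c' c : child v c -> settled (v |: S) c.
  by move/set_c; apply: settled_sub; apply: subsetUr.
split=> [u|S' dom].
  rewrite mem_rcons inE => /predU1P[->|/set_a]; last exact/settled_sub/subsetUr.
  move=> u' u'Y; apply: observed_sub (subsetUl _ _) _.
  by apply: settled_children u'Y; rewrite ?setU11.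
have [S1 [sub1 dom1 le1]] := ex S' dom.
have [S2 [sub2 dom2 le2]] := exchange sub1 dom1 str set_c'.
by exists S2; split=> //; apply: leq_trans le1.
Qed.

Lemma greedy_minimum : minimum_power_dominating e (greedy e r s).
Proof.
have := @greedy_invariant s [::]; rewrite cats0 => -[//|set_s ex]; split.
  apply/power_dominatesP => x.
  have rs : r \in s by case/andP: level_s => /perm_mem->; rewrite mem_enum.
  apply: observed_sub (set_s r rs x (subtree_root x)).
  (* The subtree of the root is the whole tree, so its [nbr] is empty and the current set alone
     observes everything. *)
  rewrite subUset subxx; apply/subsetP => y.
  by rewrite inE subtree_root.
move=> S' /ex[S'' [sub _ le]]; exact: leq_trans (subset_leq_card sub) le.
Qed.

End Level.
End Tree.

(** * A program logic with time credits *)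

Section Logic.
Implicit Types (c : cmd) (s : store) (k : nat) (Q : nat -> store -> Prop).

(* Total correctness with time credits: started in s with k credits, c halts and
   leaves a store and a number of credits related by Q. *)
Definition wp c Q k s : Prop :=
  exists s' t k', [/\ exec c s s' t, t + k' <= k & Q k' s'].

(** Arrays are addressed by name only, so there is no aliasing and this syntactic test is a sound
    frame condition. *)
Fixpoint writes c (b : name) : bool :=
  match c with
  | Skip => false
  | Put a _ _ => name_beq b a
  | Seq c1 c2 | If _ c1 c2 => writes c1 b || writes c2 b
  | While _ c1 => writes c1 b
  end.

Definition agree (wr : name -> bool) s s' : Prop :=
  forall b, ~~ wr b -> s' b =1 s b.

Lemma agree_trans wr s1 s2 s3 : agree wr s1 s2 -> agree wr s2 s3 -> agree wr s1 s3.
Proof. by move=> h1 h2 b wb i; rewrite h2 ?h1. Qed.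

Lemma agree_sub (wr wr' : name -> bool) s s' : (forall b, wr b -> wr' b) ->
  agree wr s s' -> agree wr' s s'.
Proof. by move=> sub agr b wb; apply: agr; apply: contra wb; apply: sub. Qed.

Lemma agree_update (wr : name -> bool) s a i v : wr a -> agree wr s (update s a i v).
Proof.
move=> wa b wb j; rewrite /update; case: ifP => // /andP[/internal_name_dec_bl eq_ba _].
by move: wb; rewrite eq_ba wa.
Qed.

Lemma exec_agree c s s' t : exec c s s' t -> agree (writes c) s s'.
Proof.
elim=> {c s s' t} //=.
- by move=> a i x s; apply: agree_update; apply: internal_name_dec_lb.
- move=> c1 c2 s s1 s2 t1 t2 _ h1 _ h2.
  by apply: (@agree_trans _ _ s1); [apply: agree_sub h1|apply: agree_sub h2] => b ->; rewrite ?orbT.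
- by move=> x c1 c2 s s1 t _ _; apply: agree_sub => b ->.
- by move=> x c1 c2 s s1 t _ _; apply: agree_sub => b ->; rewrite orbT.
- by move=> x c s s1 s2 t1 t2 _ _ h1 _ h2; apply: agree_trans h1 h2.
Qed.

(** The frame comes for free in the consequence rule; specifications therefore mention only what a
    command changes. *)
Lemma wp_conseq c Q Q' k s : wp c Q k s ->
  (forall k' s', agree (writes c) s s' -> Q k' s' -> Q' k' s') -> wp c Q' k s.
Proof.
move=> [s' [t [k' [ex le q]]]] sub; exists s', t, k'; split=> //.
by apply: sub q; apply: exec_agree ex.
Qed.

Lemma wp_weaken c Q k k' s : wp c Q k s -> k <= k' -> wp c Q k' s.
Proof. by move=> [s' [t [k1 [ex le q]]]] le'; exists s', t, k1; split=> //; lia. Qed.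

(** A frame rule for credits: a loop body runs on its own share while the remaining [m] are kept for
    later rounds. *)
Lemma wp_credits c Q k s m : wp c Q k s ->
  wp c (fun k' s' => exists2 k1, Q k1 s' & k1 + m = k') (k + m) s.
Proof.
move=> [s' [t [k1 [ex le q]]]]; exists s', t, (k1 + m); split=> //; first by lia.
by exists k1.
Qed.

Lemma wp_skip Q k s : 0 < k -> Q k.-1 s -> wp Skip Q k s.
Proof. by move=> k0 q; exists s, 1, k.-1; split; [constructor|lia|]. Qed.

Lemma wp_put a i x Q k s : exp_cost i + exp_cost x < k ->
  Q (k - (exp_cost i + exp_cost x).+1) (update s a (eval s i) (eval s x)) ->
  wp (Put a i x) Q k s.
Proof.
by move=> le q; do 3 eexists; split; [constructor| |exact: q]; lia.
Qed.

Lemma wp_seq c1 c2 Q k s : wp c1 (wp c2 Q) k s -> wp (Seq c1 c2) Q k s.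
Proof.
move=> [s1 [t1 [k1 [ex1 le1 [s2 [t2 [k2 [ex2 le2 q]]]]]]]].
by exists s2, (t1 + t2), k2; split=> //; [apply: ExecSeq ex1 ex2|lia].
Qed.

Lemma wp_if x c1 c2 Q k s : exp_cost x < k ->
  (if eval s x != 0 then wp c1 Q (k - (exp_cost x).+1) s
   else wp c2 Q (k - (exp_cost x).+1) s) ->
  wp (If x c1 c2) Q k s.
Proof.
move=> le; case: ifP => [nz|/negbFE/eqP z] [s' [t [k' [ex le' q]]]].
  by exists s', (exp_cost x + t).+1, k'; split=> //; [apply: ExecIfT|lia].
by exists s', (exp_cost x + t).+1, k'; split=> //; [apply: ExecIfF|lia].
Qed.

(** The credits double as the termination measure, since every round consumes at least one. *)
Lemma wp_while x c Q k s (Inv : nat -> store -> Prop) :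
  Inv k s ->
  (forall k' s', agree (writes c) s s' -> Inv k' s' -> exp_cost x < k' /\
    if eval s' x != 0 then wp c Inv (k' - (exp_cost x).+1) s'
    else exists2 k1, k1 + exp_cost x < k' & Q k1 s') ->
  wp (While x c) Q k s.
Proof.
move=> inv step; have: agree (writes c) s s by [].
move: {1 3 4}s inv; have [m] := ubnP k; elim: m k => // m IH k lt_k s' inv agr.
have [le] := step _ _ agr inv; case: ifP => [nz|/negbFE/eqP z].
  case=> s1 [t1 [k1 [ex1 le1 inv1]]].
  have [|s2 [t2 [k2 [ex2 le2 q]]]] := IH k1 _ s1 inv1 (agree_trans agr (exec_agree ex1)).
    lia.
  by do 3 eexists; split; [apply: ExecWhileT ex1 ex2 | | exact: q] => //; lia.
by case=> k1 le1 q; do 3 eexists; split; [apply: ExecWhileF | | exact: q] => //; lia.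
Qed.

(* Inv is indexed by the images under f of the indices still to come, which makes
   an empty range with hi < lo harmless. *)
Lemma wp_for (A : Type) (f : nat -> A) i lo hi body Q k k0 s b
    (Inv : seq A -> nat -> store -> Prop)
    (wr := fun z => writes body z || name_beq z i) :
  (forall s', agree wr s s' -> eval s' hi = b) ->
  ~~ writes body i ->
  k0 + (exp_cost hi + 10) * (b - eval s lo) + (exp_cost hi + exp_cost lo + 6) <= k ->
  (forall l k' s' v, Inv l k' s' -> Inv l k' (update s' i 0 v)) ->
  Inv (map f (index_iota (eval s lo) b)) k0 s ->
  (forall j k' s', eval s lo <= j < b -> agree wr s s' -> s' i 0 = j ->
     Inv (f j :: map f (index_iota j.+1 b)) k' s' ->
     wp body (Inv (map f (index_iota j.+1 b))) k' s') ->
  (forall k' s', agree wr s s' -> Inv [::] k' s' -> Q k' s') ->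
  wp (for_range i lo hi body) Q k s.
Proof.
move=> def_b wr_i le_k inv_up inv0 step post.
(* [B j] is the overhead of the rounds from [j] on, hidden behind an existential so that [lia] sees
   no product. A round costs [exp_cost hi + 4] for the test and 6 for [incr]; the first assignment
   and the failing test make up [exp_cost hi + exp_cost lo + 6]. *)
have [B [BE BS]] : exists B : nat -> nat,
    B (eval s lo) = (exp_cost hi + 10) * (b - eval s lo) /\
    forall j, j < b -> B j = B j.+1 + (exp_cost hi + 10).
  exists (fun j => (exp_cost hi + 10) * (b - j)); split=> // j lt_j.
  by rewrite [RHS]addnC -mulnS; congr (_ * _); lia.
rewrite -BE in le_k; have wri : wr i by rewrite /wr (internal_name_dec_lb (erefl i)) orbT.
apply: wp_seq; apply: wp_put; first by rewrite /=; lia.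
set s0 := update _ _ _ _.
have agr0 : agree wr s s0 by apply: agree_update.
pose Inv' k' s' := agree wr s s' /\ exists j k1,
  [/\ eval s lo <= j, s' i 0 = j, Inv (map f (index_iota j b)) k1 s'
    & k1 + B j + (exp_cost hi + 4) <= k'].
apply: (@wp_while _ _ _ _ _ Inv').
  split=> //; exists (eval s lo), k0; split=> //.
  - by rewrite /s0 /update (internal_name_dec_lb (erefl i)) eqxx.
  - exact: inv_up.
  - by rewrite /=; lia.
move=> k' s' _ [agr [j [k1 [le_j def_j inv le_k']]]]; rewrite /= (def_b _ agr) def_j.
split; first by lia.
case: (ltnP j b) => [lt_jb|le_bj] /=; last first.
  move: inv; rewrite /index_iota; have -> : b - j = 0 by lia.
  by move=> /= inv; exists k1; [lia | apply: post].
have def_l : index_iota j b = j :: index_iota j.+1 b.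
  by rewrite /index_iota; have -> : b - j = (b - j.+1).+1 by lia.
rewrite def_l in inv; have lt_j : eval s lo <= j < b by lia.
apply: wp_seq; apply: (@wp_weaken _ _ (k1 + (B j.+1 + (exp_cost hi + 10)))); last first.
  by have := BS _ lt_jb; lia.
have := wp_credits (B j.+1 + (exp_cost hi + 10)) (step _ _ _ lt_j agr def_j inv).
move/wp_conseq; apply=> k2 s2 agr2 [k3 inv3 def_k2].
have def_i : s2 i 0 = j by rewrite agr2 ?def_j.
apply: wp_put => /=; first by lia.
split.
  apply: (agree_trans (agree_trans agr _) (agree_update _ _ _ wri)).
  by apply: agree_sub agr2 => z; rewrite /wr => ->.
exists j.+1, k3; split=> //.
- by lia.
- by rewrite /update (internal_name_dec_lb (erefl i)) eqxx def_i addn1.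
- exact: inv_up.
- by rewrite -def_k2; lia.
Qed.

End Logic.

(** * Verification of the program *)

Section Program.
Variables (T : finType) (e : rel T) (r : T) (num : T -> nat) (st : store).
Hypothesis tree : is_tree e.
Hypothesis enc : encodes e r num st.
Implicit Types (s : store) (x y u v w : T) (l q : seq T).

Definition nb_nodes := #|T|.
Local Notation n := nb_nodes.
Local Notation dist := (dist e r).
Local Notation child := (child e r).

(** * Node numbers and adjacency lists *)

Definition deg x := #|e x|.

Lemma num_inj : injective num. Proof. by case: enc => -[]. Qed.
Lemma num_lt x : num x < n. Proof. by case: enc => -[]. Qed.

Definition node i := odflt r [pick x | num x == i].

Lemma numK : cancel num node.
Proof.
move=> x; rewrite /node; case: pickP => [y /eqP/num_inj //|/(_ x)].
by rewrite eqxx.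
Qed.

(** An injection of a type with [n] elements into ['I_n] is onto. *)
Lemma nodeK i : i < n -> num (node i) = i.
Proof.
move=> lt_i; pose f x : 'I_n := Ordinal (num_lt x).
have inj_f : injective f by move=> x y /(congr1 val)/num_inj.
have [g gK fK] : bijective f by apply: inj_card_bij; rewrite ?card_ord.
have /(congr1 val) /= <- := fK (Ordinal lt_i); by rewrite numK.
Qed.

Definition nodes := map node (index_iota 0 n).

Lemma uniq_nodes : uniq nodes.
Proof.
rewrite map_inj_in_uniq ?iota_uniq // => i j; rewrite !mem_index_iota => lt_i lt_j eq_ij.
by rewrite -(nodeK lt_i) -(nodeK lt_j) eq_ij.
Qed.

Lemma mem_nodes x : x \in nodes.
Proof. by apply/mapP; exists (num x); rewrite ?numK // mem_index_iota num_lt. Qed.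

Lemma size_nodes : size nodes = n.
Proof. by rewrite size_map size_iota subn0. Qed.

Lemma sum_nodes (F : T -> nat) : \sum_(x <- nodes) F x = \sum_x F x.
Proof.
rewrite -[RHS]big_enum; apply: perm_big; apply: uniq_perm; rewrite ?enum_uniq ?uniq_nodes //.
by move=> x; rewrite mem_nodes mem_enum.
Qed.

(** Read in the initial store [st], so that all specifications name the same list; [graph] transfers
    it to the current store. *)
Definition adj x :=
  map (fun k => node (st TGT k)) (index_iota (st OFF (num x)) (st OFF (num x).+1)).

Lemma perm_adj x : perm_eq (adj x) (enum (e x)).
Proof.
case: enc => _ _ _ /(_ x)/(perm_map node); rewrite -!map_comp.
by rewrite (eq_map (g := id)) ?map_id // => y /=; rewrite numK.
Qed.

Lemma mem_adj x y : (y \in adj x) = e x y.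
Proof. by rewrite (perm_mem (perm_adj x)) mem_enum. Qed.

Lemma uniq_adj x : uniq (adj x).
Proof. by rewrite (perm_uniq (perm_adj x)) enum_uniq. Qed.

Lemma size_adj x : size (adj x) = deg x.
Proof. by rewrite (perm_size (perm_adj x)) -cardE. Qed.

Lemma degE x : deg x = st OFF (num x).+1 - st OFF (num x).
Proof. by rewrite -size_adj size_map size_iota. Qed.

Lemma targetK x j : st OFF (num x) <= j < st OFF (num x).+1 ->
  num (node (st TGT j)) = st TGT j.
Proof.
move=> lt_j; case: enc => _ _ _ /(_ x)/perm_mem/(_ (st TGT j)).
rewrite map_f ?mem_index_iota // => /esym/mapP[y _ ->]; by rewrite numK.
Qed.

(** * Loops over the nodes and over the neighbours of a node *)

Definition graph s := [/\ s N 0 = n, s OFF =1 st OFF & s TGT =1 st TGT].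

Lemma graph_agree (wr : name -> bool) s s' : agree wr s s' ->
  ~~ wr N -> ~~ wr OFF -> ~~ wr TGT -> graph s -> graph s'.
Proof.
by move=> agr wN wO wT [gN gO gT]; split=> [|i|i]; rewrite agr.
Qed.

(** Reading [N] costs 2, which turns the overhead of [wp_for] into 12 per round and 9 once. The
    invariant depends on the list of nodes to come, so it can carry a sum of costs over them. *)
Lemma wp_nodes i body Q k k0 s (Inv : seq T -> nat -> store -> Prop)
    (wr := fun z => writes body z || name_beq z i) :
  graph s -> ~~ writes body i -> ~~ wr N ->
  k0 + 12 * n + 9 <= k ->
  (forall l k' s' j, Inv l k' s' -> Inv l k' (update s' i 0 j)) ->
  Inv nodes k0 s ->
  (forall x l k' s', agree wr s s' -> s' i 0 = num x -> uniq (x :: l) ->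
     Inv (x :: l) k' s' -> wp body (Inv l) k' s') ->
  (forall k' s', agree wr s s' -> Inv [::] k' s' -> Q k' s') ->
  wp (for_range i (Num 0) (Get N (Num 0)) body) Q k s.
Proof.
move=> [gN _ _] wr_i wr_N le_k up inv0 step post.
apply: (@wp_for _ node _ _ _ _ _ _ k0 _ n Inv) => //=; first by move=> s' /(_ N wr_N) ->.
  by rewrite subn0; lia.
move=> j k' s' lt_j agr def_j; apply: step => //; first by rewrite nodeK.
rewrite -map_cons map_inj_in_uniq; first by rewrite /= iota_uniq mem_iota ltnn.
move=> a b; rewrite !inE !mem_index_iota => ia ib eq_ab.
have [lt_a lt_b] : a < n /\ b < n by lia.
by rewrite -(nodeK lt_a) -(nodeK lt_b) eq_ab.
Qed.

(** The upper bound costs 5 and the lower one 3, giving 15 per round and 14 once; loading the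
    neighbour into [w] adds 5 per round, which [Inv'] sets aside. *)
Lemma wp_nbr i (w u : name) body Q k k0 s x (Inv : seq T -> nat -> store -> Prop)
    (wr := fun z => [|| writes body z, name_beq z i | name_beq z w]) :
  graph s -> s u 0 = num x -> ~~ writes body i -> ~~ name_beq i w ->
  ~~ writes body w -> ~~ wr u -> ~~ wr OFF -> ~~ wr TGT ->
  k0 + 20 * deg x + 14 <= k ->
  (forall l k' s' j, Inv l k' s' -> Inv l k' (update s' i 0 j)) ->
  (forall l k' s' j, Inv l k' s' -> Inv l k' (update s' w 0 j)) ->
  Inv (adj x) k0 s ->
  (forall y l k' s', agree wr s s' -> s' w 0 = num y -> e x y ->
     uniq (y :: l) -> Inv (y :: l) k' s' -> wp body (Inv l) k' s') ->
  (forall k' s', agree wr s s' -> Inv [::] k' s' -> Q k' s') ->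
  wp (for_nbr i w u body) Q k s.
Proof.
move=> [_ gO gT] su wr_i neq_iw wr_w wr_u wr_O wr_T le_k up_i up_w inv0 step post.
have eq_wr z : writes (Put w (Num 0) (Get TGT (Get i (Num 0)));; body) z || name_beq z i = wr z.
  by rewrite /wr /=; case: (writes _ _); case: (name_beq z i); case: (name_beq z w).
pose Inv' l k' s' := exists2 k1, Inv l k1 s' & k1 + 5 * size l = k'.
have agr_wr s' : agree (fun z => writes (Put w (Num 0) (Get TGT (Get i (Num 0)));; body) z
    || name_beq z i) s s' -> agree wr s s'.
  by apply: agree_sub => b; rewrite eq_wr.
apply: (@wp_for _ (fun k => node (st TGT k)) _ _ _ _ _ _ (k0 + 5 * deg x) _
  (st OFF (num x).+1) Inv') => //=.
- move=> s' /agr_wr agr; rewrite !agr //= su addn1; exact: gO.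
- by rewrite negb_or neq_iw.
- by rewrite gO su -degE; lia.
- by move=> l k' s' v [k1 inv le]; exists k1 => //; apply: up_i.
- by exists k0; [rewrite gO su; exact: inv0|rewrite gO su -/(adj x) size_adj].
- rewrite gO su => j k' s' lt_j /agr_wr agr def_j [k1 inv le_k'].
  have tj : s' TGT j = st TGT j by rewrite agr ?gT.
  apply: wp_seq; apply: wp_put; rewrite /= in le_k' *; first by lia.
  rewrite def_j tj.
  pose l := map (fun k => node (st TGT k)) (index_iota j.+1 (st OFF (num x).+1)).
  apply: (@wp_weaken _ _ (k1 + 5 * size l)); last by rewrite /l; lia.
  apply: (wp_conseq (wp_credits _ (step (node (st TGT j)) l _ _ _ _ _ _ _))).
  + apply: (agree_trans agr); apply: agree_update.
    by rewrite /wr (internal_name_dec_lb (erefl w)) !orbT.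
  + by rewrite /update (internal_name_dec_lb (erefl w)) eqxx (targetK lt_j).
  + by rewrite -mem_adj; apply/mapP; exists j; rewrite ?mem_index_iota.
  + have := uniq_adj x; rewrite /adj; have -> : index_iota (st OFF (num x)) (st OFF (num x).+1) =
      index_iota (st OFF (num x)) j ++ j :: index_iota j.+1 (st OFF (num x).+1).
      rewrite /index_iota; have -> : st OFF (num x).+1 - st OFF (num x) =
        (j - st OFF (num x)) + (st OFF (num x).+1 - j.+1).+1 by lia.
      by rewrite iotaD; congr (_ ++ _); rewrite subnKC //; lia.
    by rewrite map_cat cat_uniq => /and3P[].
  + exact: up_w.
  + by move=> k2 s2 _ [k3 inv3 def_k2]; exists k3.
by move=> k' s' /agr_wr agr [k1 inv <-]; rewrite addn0; apply: post.
Qed.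

(** * The power closure by a queue *)

Definition arr s a : {set T} := [set x | s a (num x) != 0].

Lemma update_num s a y (v : nat) x :
  update s a (num y) v a (num x) = if x == y then v else s a (num x).
Proof. by rewrite /update (internal_name_dec_lb (erefl a)) (inj_eq num_inj). Qed.

(** [q] is the whole history of the queue: dequeued nodes stay as a prefix, delimited elsewhere by
    [HD]. This is why membership in [q] and the marks in [P] coincide. *)
Definition queue q s :=
  [/\ s TL 0 = size q, forall i, i < size q -> s QUEUE i = num (nth r q i), uniq q
    & forall x, (s P (num x) != 0) = (x \in q)].

Lemma wp_insert (z : name) y q k s : z = U \/ z = W \/ z = X ->
  queue q s -> s z 0 = num y -> 20 <= k ->
  wp (insert z) (fun k' s' => k <= k' + 20 /\
    queue (if y \in q then q else rcons q y) s') k s.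
Proof.
move=> z_in [tlE qE uq pE] sz le_k.
case: ifP (pE y) => [yq Py|yq /negbFE/eqP Py].
  apply: wp_if => /=; first by lia.
  by rewrite sz Py; apply: wp_skip; [lia | split; [lia|]].
apply: wp_if => /=; first by lia.
rewrite sz Py /=; apply: wp_seq; apply: wp_put => /=; first by lia.
apply: wp_seq; apply: wp_put => /=; first by lia.
apply: wp_put => /=; first by lia.
split; first by lia.
have sz' : update s P (num y) 1 z 0 = num y by case: z_in => [->|[->|->]] in sz *.
rewrite sz sz'; split.
- by rewrite /update /= tlE size_rcons addn1.
- move=> i; rewrite size_rcons nth_rcons /update /= tlE ltnS leq_eqVlt.
  by case: eqP => [-> _|/= _ lt_i]; rewrite ?ltnn ?eqxx // lt_i qE.
- by rewrite rcons_uniq yq.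
move=> x; rewrite mem_rcons inE -pE /update /= (inj_eq num_inj).
by case: (x == y).
Qed.

Definition fires s y := s CNT (num y) + 1 == deg y.

Lemma wp_propagate (z : name) y q k s : z = U \/ z = W -> graph s ->
  queue q s -> s z 0 = num y ->
  40 + (if fires s y then 40 * deg y else 0) <= k ->
  wp (propagate z) (fun k' s' =>
    k <= k' + (40 + (if fires s y then 40 * deg y else 0)) /\
    exists q', [/\ queue (q ++ q') s', forall w, w \in q' -> fires s y /\ e y w
      & fires s y -> forall w, e y w -> w \in q ++ q']) k s.
Proof.
move=> z_in gs qs sz le_k; have [_ gO _] := gs.
apply: wp_if => /=; first by lia.
rewrite sz !gO [num y + 1]addn1.
have -> : (st OFF (num y) + (s CNT (num y) + 1) == st OFF (num y).+1) = fires s y.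
  by rewrite /fires degE; lia.
case: ifP => fy; last first.
  have -> : fires s y = false by move: fy; case: (fires s y).
  apply: wp_skip => /=; first by lia.
  by split; [lia | exists [::]; split; rewrite ?cats0].
have {}fy : fires s y by move: fy; case: (fires s y).
rewrite fy in le_k *.
pose Inv l k' (s' : store) := (k <= k' + (40 * deg y + 40 - 20 * size l)) /\
  size l <= deg y /\
  exists q', [/\ queue (q ++ q') s', {subset q' <= adj y}
    & forall w, e y w -> w \notin l -> w \in q ++ q'].
apply: (@wp_nbr _ _ _ _ _ _ (k - 20 * deg y - 30) _ y Inv) => //.
- by case: z_in => ->.
- by rewrite /=; lia.
- rewrite /Inv size_adj; split; first by lia.
  split=> //; exists [::]; rewrite cats0; split=> // w eyw.
  by rewrite mem_adj eyw.
- move=> w l k' s' _ sw eyw uwl [le_k' [le_l [q' [qs' sub cov]]]].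
  rewrite /= in le_l le_k'.
  apply: (wp_conseq (wp_insert (z := X) (y := w) _ qs' sw _)) => //; first by auto.
    by lia.
  move=> k2 s2 _ [le2 qs2]; split; first by lia.
  split; first by lia.
  case: ifP qs2 => [wq qs2|wq qs2].
    exists q'; split=> // v eyv vl; have [->//|neq] := eqVneq v w.
    by apply: cov; rewrite // inE negb_or neq.
  exists (rcons q' w); rewrite -rcons_cat; split=> // v.
    by rewrite mem_rcons inE => /predU1P[->|/sub//]; rewrite mem_adj.
  move=> eyv vl; rewrite mem_rcons inE; have [//|neq] := eqVneq v w.
  by apply: cov; rewrite // inE negb_or neq.
move=> k' s' _ [le_k' [_ [q' [qs' sub cov]]]].
split; first by move: le_k'; rewrite /=; lia.
exists q'; split=> // [w /sub|_ w eyw]; first by rewrite mem_adj.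
exact: cov.
Qed.

(** Rule 2 in counting form: [C] misses exactly one neighbour of [x], so a neighbour outside [C] is
    the one that [x] forces. *)
Lemma observed_forced D x (C : {set T}) : observed e D x ->
  C \subset [set y | e x y] -> {in C, forall y, observed e D y} ->
  #|C| + 1 = deg x -> forall y, e x y -> observed e D y.
Proof.
move=> ox sub oC card_C y exy.
have [yC|yC] := boolP (y \in C); first exact: oC.
apply: (ObsForce ox exy) => u exu neq; apply: oC; apply: contraT => uC.
have /eqP/cards1P[z def_z] : #|[set y | e x y] :\: C| = 1.
  have card_N : #|[set y | e x y]| = deg x by rewrite cardsE.
  by rewrite cardsD (setIidPr sub) card_N; lia.
have eq_z v : e x v -> v \notin C -> v = z.
  by move=> exv vC; apply/set1P; rewrite -def_z !inE vC.
by case/eqP: neq; rewrite (eq_z u exu uC) (eq_z y exy yC).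
Qed.

Definition sumdeg := \sum_x deg x.
(* The potential that pays for propagating x when its count reaches deg x - 1. *)
Definition idle s := \sum_x (if s CNT (num x) + 1 < deg x then deg x else 0).

Lemma idle_le s : idle s <= sumdeg.
Proof. by apply: leq_sum => x _; case: ifP. Qed.

(** If the increment makes [w] fire, [w] drops out of the sum at that moment and releases its
    degree; otherwise its term does not grow. *)
Lemma idle_incr s w (s' := update s CNT (num w) (s CNT (num w) + 1)) :
  idle s' + (if fires s' w then deg w else 0) <= idle s.
Proof.
rewrite /idle (bigD1 w) //= [X in _ <= X](bigD1 w) //= /fires /s' update_num eqxx.
rewrite [X in _ + X + _](eq_bigr (fun x => if s CNT (num x) + 1 < deg x then deg x else 0)).
  by case: ifP; case: ifP; case: ifP; lia.
by move=> x neq; rewrite update_num (negPf neq).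
Qed.

Lemma sum_notin_rcons (F : T -> nat) (a : seq T) u : u \notin a ->
  \sum_(x | x \notin a) F x = F u + \sum_(x | x \notin rcons a u) F x.
Proof.
move=> ua; rewrite (bigD1 u) //=; congr (_ + _); apply: eq_bigl => x.
by rewrite mem_rcons inE negb_or andbC.
Qed.

(** Soundness of the queue together with completeness for Rule 1; completeness for Rule 2 is
    [settled_by], with [a] the dequeued nodes. *)
Definition covers D q s :=
  [/\ queue q s, {in q, forall x, observed e D x}, {subset D <= q}
    & forall x y, x \in D -> e x y -> y \in q].

Lemma covers_cat D q q' s s' : covers D q s -> queue (q ++ q') s' ->
  {in q', forall x, observed e D x} -> covers D (q ++ q') s'.
Proof.
move=> [_ oq sub nb] qs' oq'; split=> // [x|x /sub|x y xD exy].
- by rewrite mem_cat => /orP[/oq|/oq'].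
- by rewrite mem_cat => ->.
- by rewrite mem_cat (nb x).
Qed.

Definition settled_by (a q : seq T) s :=
  forall x, x \in a -> fires s x -> forall y, e x y -> y \in q.

(** Linear terms: [24 * n] for clearing, [60 * n + 40 * sumdeg] for Rule 1, and
    [100 * n + 160 * sumdeg] for the main loop, of which [40 * sumdeg] covers the initial [idle]. *)
Definition closure_cost := 190 * n + 200 * sumdeg + 100.

Lemma wp_initial_queue D k s : graph s -> arr s DOM = D -> queue [::] s ->
  60 * n + 40 * sumdeg + 30 <= k ->
  wp (for_range U (Num 0) (Get N (Num 0))
    (If (Get DOM (Get U (Num 0))) (insert U;; for_nbr K W U (insert W)) Skip))
    (fun k' s' => k <= k' + (60 * n + 40 * sumdeg + 30) /\ exists q, covers D q s') k s.
Proof.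
move=> gs defD qs0 le_k.
pose cost x := 40 + 40 * deg x.
have costE : \sum_(x <- nodes) cost x = 40 * n + 40 * sumdeg.
  by rewrite sum_nodes big_split /= sum_nat_const mulnC -big_distrr.
pose inq (l : seq T) q := forall x, x \in D -> x \notin l -> x \in q /\ (forall y, e x y -> y \in q).
pose Inv l k' s' := k + \sum_(x <- l) cost x <= k' + (52 * n + 40 * sumdeg + 9) /\
  \sum_(x <- l) cost x <= k' /\
  exists q, [/\ queue q s', {in q, forall x, observed e D x} & inq l q].
apply: (@wp_nodes _ _ _ _ (k - 12 * n - 9) _ Inv) => //.
- by lia.
- rewrite /Inv costE; split; first by lia.
  split; first by lia.
  by exists [::]; split=> // x _; rewrite mem_nodes.
- move=> x l k1 s1 agr1 sU uxl [le1 [le1' [q [qs oq inq1]]]].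
  rewrite !big_cons in le1 le1'; rewrite {1}/cost in le1; rewrite {1}/cost in le1'.
  have gs1 : graph s1 by apply: (graph_agree agr1).
  apply: wp_if => /=; first by lia.
  have -> : (s1 DOM (s1 U 0) != 0) = (x \in D) by rewrite sU -defD inE agr1.
  case: ifP => xD; last first.
    apply: wp_skip; first by lia.
    split; first by lia.
    split; first by lia.
    exists q; split=> // y yD yl; apply: inq1 => //; rewrite inE negb_or yl andbT.
    by apply: contraFneq xD => <-.
  apply: wp_seq; apply: (wp_conseq (wp_insert (z := U) (y := x) _ qs sU _)); first by left.
    by lia.
  move=> k2 s2 agr2; set q2 := (if _ then _ else _) => -[le2 qs2].
  have q2E y : y \in q2 = (y == x) || (y \in q).
    rewrite /q2; case: ifP => [xq|_]; last by rewrite mem_rcons.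
    by case: eqP => // ->.
  have gs2 : graph s2 by apply: (graph_agree agr2).
  pose Inv2 (m : seq T) k' s' := k2 + 20 * size m <= k' + (14 + 40 * deg x) /\ 20 * size m <= k' /\
    exists q', [/\ queue q' s', {in q', forall x, observed e D x}, {subset q2 <= q'}
      & forall y, e x y -> y \notin m -> y \in q'].
  apply: (@wp_nbr _ _ _ _ _ _ (k2 - 20 * deg x - 14) _ x Inv2) => //.
  + by rewrite agr2.
  + by lia.
  + rewrite /Inv2 size_adj; split; first by lia.
    split; first by lia.
    exists q2; split=> // [y|y exy]; last by rewrite mem_adj exy.
    by rewrite q2E => /predU1P[->|/oq//]; apply: ObsIn.
  + move=> w m k3 s3 _ sw exw _ [le3 [le3' [q3 [qs3 oq3 sub3 cov3]]]].
    rewrite /= in le3 le3'.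
    apply: (wp_conseq (wp_insert (z := W) (y := w) _ qs3 sw _)); first by right; left.
      by lia.
    move=> k4 s4 _; set q4 := (if _ then _ else _) => -[le4 qs4].
    have q4E y : y \in q4 = (y == w) || (y \in q3).
      rewrite /q4; case: ifP => [wq|_]; last by rewrite mem_rcons.
      by case: eqP => // ->.
    split; first by lia.
    split; first by lia.
    exists q4; split=> // [y|y yq|y exy ym].
    * by rewrite q4E => /predU1P[->|/oq3//]; apply: ObsNbr exw.
    * by rewrite q4E sub3 ?orbT.
    * rewrite q4E; have [//|neq] := eqVneq y w.
      by apply: cov3; rewrite // inE negb_or neq.
  move=> k3 s3 _ [le3 [_ [q3 [qs3 oq3 sub3 cov3]]]]; rewrite /= in le3.
  split; first by lia.
  split; first by lia.
  exists q3; split=> // y yD yl; have [->|neq] := eqVneq y x.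
    split; first by apply: sub3; rewrite q2E eqxx.
    by move=> z exz; apply: cov3.
  have [|yq nb] := inq1 y yD; first by rewrite inE negb_or neq.
  by split=> [|z /nb zq]; apply: sub3; rewrite q2E ?yq ?zq orbT.
move=> k' s' _ [le1 [_ [q [qs oq inq1]]]]; rewrite big_nil in le1.
split; first by lia.
by exists q; split=> // [x xD|x y xD exy]; have [xq nb] := inq1 x xD isT => //; apply: nb.
Qed.

(** One round of the main loop, once [u] has left the queue. The node [u] itself may cost
    [40 + 40 * deg u], the loop overhead is [14 + 20 * deg u], and each neighbour gets 60; a
    neighbour that fires is paid by the drop of [idle]. *)
Lemma wp_dequeue D (a b : seq T) u k s : graph s -> covers D (a ++ u :: b) s ->
  s HD 0 = (size a).+1 -> s U 0 = num u ->
  (forall x, s CNT (num x) = #|[set y | e x y & y \in a]|) ->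
  settled_by a (a ++ u :: b) s ->
  80 + 120 * deg u + 40 * idle s <= k ->
  wp (propagate U;;
      for_nbr K W U
       (Put CNT (Get W (Num 0)) (Add (Get CNT (Get W (Num 0))) (Num 1));;
        If (Get P (Get W (Num 0))) (propagate W) Skip))
    (fun k' s' => k + 40 * idle s' <= k' + (80 + 120 * deg u + 40 * idle s) /\
      exists b', [/\ covers D (a ++ u :: b') s',
       (forall x, s' CNT (num x) = #|[set y | e x y & y \in rcons a u]|)
       & settled_by (rcons a u) (a ++ u :: b') s']) k s.
Proof.
move=> gs cov hdE sU cntE sett le_k.
have ua : u \notin a.
  by case: cov => -[_ _ + _] _ _ _; rewrite cat_uniq /= => /and3P[_ /norP[]].
(* Firing is sound because the counted neighbours are in the queue, hence observed, and only one
   neighbour is not counted. *)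
have sound s1 q x (C : {set T}) : covers D q s1 -> x \in q -> C \subset [set y | e x y] ->
    {subset C <= q} -> s1 CNT (num x) = #|C| -> fires s1 x ->
    forall y, e x y -> observed e D y.
  move=> [_ oq _ _] xq sub subq cE /eqP; rewrite cE => cardC.
  by apply: (observed_forced (oq _ xq) sub) cardC => y /subq/oq.
have uq : u \in a ++ u :: b by rewrite mem_cat mem_head orbT.
have [qs _ _ _] := cov.
apply: wp_seq; apply: (wp_conseq (wp_propagate (z := U) (y := u) _ gs qs sU _)); first by left.
  by case: (fires s u); lia.
move=> k1 s1 agr1 [le1 [q1 [qs1 snd1 cmp1]]].
have cov1 : covers D (a ++ u :: (b ++ q1)) s1.
  rewrite -cat_cons catA; apply: (covers_cat cov qs1) => w /snd1[fu euw].
  apply: (sound s _ u _ cov uq _ _ (cntE u) fu w euw).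
    by apply/subsetP => y; rewrite !inE => /andP[].
  by move=> y; rewrite inE mem_cat => /andP[_ ->].
have cnt1 x : s1 CNT (num x) = s CNT (num x) by rewrite agr1.
have gs1 : graph s1 by apply: (graph_agree agr1).
have sU1 : s1 U 0 = num u by rewrite agr1.
have le_k1 : k <= k1 + (40 + 40 * deg u) by move: le1; case: (fires s u); lia.
have idle1 : idle s1 = idle s by apply: eq_bigr => x _; rewrite cnt1.
(* Midway through the loop [u] is counted as a dequeued neighbour only at the nodes outside [l]. *)
pose Inv l k' s' :=
  k1 + 40 * idle s' + 60 * size l <= k' + 14 + 20 * deg u + 60 * deg u + 40 * idle s /\
  60 * size l + 40 * idle s' <= k' /\
  exists b', [/\ covers D (a ++ u :: b') s',
    (forall x, s' CNT (num x) = #|[set y | e x y & (y \in a) || (y == u) && (x \notin l)]|)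
    & settled_by (rcons a u) (a ++ u :: b') s'].
apply: (@wp_nbr _ _ _ _ _ _ (k1 - 20 * deg u - 14) _ u Inv) => //.
- by lia.
- split; first by rewrite size_adj idle1; lia.
  split; first by rewrite size_adj idle1; lia.
  exists (b ++ q1); split=> // [x|x].
    rewrite cnt1 cntE; apply: eq_card => y; rewrite !inE mem_adj (tree_sym tree u x).
    by case: (y \in a) => //=; case: eqP => [->|]; case: (e x _).
  rewrite mem_rcons inE /fires cnt1 => /predU1P[->|xa] fx y exy.
    by have := cmp1 fx y exy; rewrite -catA cat_cons.
  have := sett x xa fx y exy; rewrite !mem_cat !inE mem_cat; by case/or3P => ->; rewrite ?orbT.
- move=> w l k2 s2 agr2 sw euw uwl [lea [leb [b' [cov2 cnt2 sett2]]]].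
  have wl : w \notin l by case/andP: uwl.
  have gs2 : graph s2 by apply: (graph_agree agr2).
  rewrite /= in lea leb.
  apply: wp_seq; apply: wp_put => /=; first by lia.
  rewrite sw; set s3 := update _ _ _ _.
  have idle3 : idle s3 + (if fires s3 w then deg w else 0) <= idle s2 := idle_incr s2 w.
  have qs3 : queue (a ++ u :: b') s3 by case: cov2.
  have cov3 : covers D (a ++ u :: b') s3 by case: cov2.
  have cnt3 x : s3 CNT (num x) = #|[set y | e x y & (y \in a) || (y == u) && (x \notin l)]|.
    rewrite /s3 update_num; case: eqP => [->|neq].
      rewrite cnt2 [RHS](cardsD1 u) !inE !eqxx wl orbT andbT (tree_sym tree w) euw addnC.
      congr (_ + _); apply: eq_card => y; rewrite !inE /= andbF orbF.
      by case: eqP => [->|]; rewrite ?(negPf ua) ?andbF //= orbF.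
    rewrite cnt2; apply: eq_card => y; rewrite !inE negb_or.
    by move/eqP: neq => ->.
  have sett3 x : x != w -> x \in rcons a u -> fires s3 x -> forall y, e x y -> y \in a ++ u :: b'.
    by move=> neq xa fx; apply: sett2 => //; move: fx; rewrite /fires /s3 update_num (negPf neq).
  have uaP y : y \in rcons a u -> y \in a ++ u :: b'.
    by rewrite mem_rcons mem_cat !inE => /orP[]->; rewrite ?orbT.
  apply: wp_if => /=; first by lia.
  have sw3 : s3 W 0 = num w by [].
  have [_ _ _ /(_ w)] := qs3.
  rewrite -[s3 W 0]/(s2 W 0) sw => ->; case: ifP => wq; last first.
    (* A node that is not queued has not been dequeued, so [settled_by] asks nothing of it; it is
       tested when it leaves the queue itself. *)
    apply: wp_skip; first by lia.
    split; first by lia.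
    split; first by lia.
    exists b'; split=> // x xa; apply: sett3 => //.
    by apply: contraFneq wq => <-; apply: uaP.
  have gs3 : graph s3 by case: gs2.
  apply: (wp_conseq (wp_propagate (z := W) (y := w) _ gs3 qs3 sw3 _)); first by right.
    by move: idle3; case: (fires s3 w); lia.
  move=> k4 s4 agr4 [le4 [q4 [qs4 snd4 cmp4]]].
  have cnt4 x : s4 CNT (num x) = s3 CNT (num x) by rewrite agr4.
  have idle4 : idle s4 = idle s3 by apply: eq_bigr => x _; rewrite cnt4.
  split; first by rewrite idle4; move: le4 idle3; case: (fires s3 w); lia.
  split; first by rewrite idle4; move: le4 idle3; case: (fires s3 w); lia.
  exists (b' ++ q4); rewrite -cat_cons catA; split.
  + apply: (covers_cat cov3 qs4) => y /snd4[fw ewy].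
    apply: (sound s3 _ w _ cov3 wq _ _ (cnt3 w) fw y ewy).
      by apply/subsetP => v; rewrite !inE => /andP[].
    move=> v; rewrite inE => /andP[_ /orP[va|/andP[/eqP-> _]]]; first by rewrite mem_cat va.
    by rewrite mem_cat mem_head orbT.
  + by move=> x; rewrite cnt4.
  + move=> x xa fx y exy; have {}fx : fires s3 x by rewrite /fires -cnt4.
    have [def_x|neq] := eqVneq x w; first by apply: cmp4; rewrite -?def_x.
    by rewrite mem_cat (sett3 x).
move=> k' s' _ [lea [leb [b' [cov2 cnt2 sett2]]]].
split; first by rewrite /= in lea; lia.
exists b'; split=> // x; rewrite cnt2; apply: eq_card => y.
by rewrite !inE mem_rcons inE andbT orbC.
Qed.

Lemma wp_power_closure D k s : graph s -> arr s DOM = D -> closure_cost <= k ->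
  wp compute_power_closure (fun k' s' => k <= k' + closure_cost /\
    arr s' P = power_closure e D) k s.
Proof.
move=> gs defD le_k; rewrite /closure_cost in le_k *.
apply: wp_seq.
pose Inv0 l k' s' := k <= k' + (12 * n + 9) + 12 * n - 12 * size l /\ size l <= n /\
  forall x, x \notin l -> s' P (num x) = 0 /\ s' CNT (num x) = 0.
apply: (@wp_nodes _ _ _ _ (k - 12 * n - 9) _ Inv0) => //.
- by lia.
- by rewrite /Inv0 size_nodes; split; [lia | split=> // x; rewrite mem_nodes].
- move=> x l k' s' _ sI _ [le1 [le2 inv]]; rewrite /= in le1 le2.
  apply: wp_seq; apply: wp_put => /=; first by lia.
  apply: wp_put => /=; first by lia.
  split; first by lia.
  split; first by lia.
  move=> y yl; rewrite /update /= sI !(inj_eq num_inj).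
  by have [//|neq] := eqVneq y x; apply: inv; rewrite inE negb_or neq.
move=> k1 s1 agr1 [le1 [_ inv1]]; rewrite /= in le1.
have gs1 : graph s1 by apply: (graph_agree agr1).
have D1 : arr s1 DOM = D by rewrite -defD; apply/setP => x; rewrite !inE agr1.
have cnt1 x : s1 CNT (num x) = 0 by case: (inv1 x isT).
have p1 x : s1 P (num x) = 0 by case: (inv1 x isT).
apply: wp_seq; apply: wp_put => /=; first by lia.
apply: wp_seq; apply: wp_put => /=; first by lia.
set s2 := update _ TL _ _.
apply: wp_seq; apply: (wp_conseq (@wp_initial_queue D _ s2 _ _ _ _)).
- by case: gs1.
- exact: D1.
- split=> // x; rewrite in_nil -[s2 P _]/(s1 P (num x)) p1 //.
- by lia.
move=> k3 s3 agr3 [le3 [q3 cov3]].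
have gs3 : graph s3 by apply: (graph_agree agr3); case: gs1.
have cnt3 x : s3 CNT (num x) = 0 by rewrite agr3 //; apply: cnt1.
have hd3 : s3 HD 0 = 0 by rewrite agr3.
(* The cost of [wp_dequeue], with 20 more for the loop test (6), reading the queue (5) and advancing
   [HD] (6). *)
pose cost x := 100 + 120 * deg x.
have costE : \sum_x cost x = 100 * n + 120 * sumdeg.
  by rewrite big_split /= sum_nat_const mulnC -big_distrr.
pose Inv k' s' := exists a b, [/\ s' HD 0 = size a, covers D (a ++ b) s',
  (forall x, s' CNT (num x) = #|[set y | e x y & y \in a]|),
  settled_by a (a ++ b) s'
  & k3 + \sum_(x | x \notin a) cost x + 40 * idle s' <= k' + (100 * n + 160 * sumdeg) /\
    \sum_(x | x \notin a) cost x + 40 * idle s' + 10 <= k'].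
apply: (@wp_while _ _ _ _ _ Inv).
  have idle_s3 := idle_le s3.
  exists [::], q3; split=> //.
    by move=> x; rewrite cnt3 (eq_card0 _) // => y; rewrite !inE andbF.
  have -> : \sum_(x | x \notin [::]) cost x = 100 * n + 120 * sumdeg by rewrite -costE; apply: eq_bigl.
  by split; lia.
move=> k4 s4 agr4 [a [b [hd4 cov4 cnt4 sett4 [le4 le4']]]].
have gs4 : graph s4 by apply: (graph_agree agr4).
have [qs4 oq4 subD4 nb4] := cov4; have [tl4 qE4 uq4 p4] := qs4.
split; first by rewrite /=; lia.
rewrite /= hd4 tl4 size_cat -[X in X < _]addn0 ltn_add2l.
case: b => [|u b] /= in cov4 sett4 qs4 oq4 subD4 nb4 tl4 qE4 uq4 p4 *.
  rewrite cats0 in cov4 sett4 qs4 oq4 subD4 nb4 tl4 qE4 uq4 p4.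
  exists (k4 - 6); first by lia.
  split; first by lia.
  apply/setP => x; rewrite inE p4; apply/idP/power_closureP => [/oq4 //|].
  elim=> {x} [x|x y xD exy|x y _ xa exy _ IH]; [exact: subD4 | exact: nb4 exy |].
  (* The queue is empty, so every observed neighbour of [x] met in the induction has been dequeued.
     Were [y] missing, the count of [x] would be its degree minus one, and [settled_by] would have
     queued [y]. *)
  apply: contraT => ya.
  suff fx : fires s4 x by have := sett4 x xa fx y exy; rewrite (negPf ya).
  rewrite /fires cnt4; have := cardsD1 y [set z | e x z]; rewrite cardsE -/(deg x) inE exy.
  move=> ->; rewrite addnC eqn_add2l; apply/eqP; apply: eq_card => z; rewrite !inE.
  have [->|neq] := eqVneq z y; first by rewrite (negPf ya) andbF.
  by case exz: (e x z) => //=; rewrite (IH z exz neq).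
have ua : u \notin a.
  by move: uq4; rewrite cat_uniq /= => /and3P[_ /norP[]].
rewrite (sum_notin_rcons _ ua) in le4 le4'; rewrite {1}/cost in le4; rewrite {1}/cost in le4'.
apply: wp_seq; apply: wp_put => /=; first by lia.
apply: wp_seq; apply: wp_put => /=; first by lia.
set s5 := update _ HD _ _.
apply: (wp_conseq (@wp_dequeue D a b u _ s5 _ _ _ _ _ _ _)) => //.
- by rewrite /s5 /update /= hd4 addn1.
- by rewrite /s5 /update /= hd4 qE4 ?nth_cat ?ltnn ?subnn // size_cat /= -[X in X < _]addn0 ltn_add2l.
- by rewrite -[idle s5]/(idle s4); lia.
move=> k6 s6 agr6 [le6 [b' [cov6 cnt6 sett6]]]; rewrite -[idle s5]/(idle s4) in le6.
exists (rcons a u), b'; rewrite cat_rcons; split=> //.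
  by rewrite agr6 // size_rcons /s5 /update /= hd4 addn1.
by split; lia.
Qed.

(** * The boundary of a region and the test for strength *)

Lemma arr_insert s a y : arr (update s a (num y) 1) a = y |: arr s a.
Proof.
by apply/setP => x; rewrite !inE update_num; case: (x == y).
Qed.

Lemma wp_dom k s : graph s -> 60 * n + 30 * sumdeg + 20 <= k ->
  wp compute_dom (fun k' s' => k <= k' + (60 * n + 30 * sumdeg + 20) /\
    arr s' DOM = arr s OUT :|: nbr e (arr s Y)) k s.
Proof.
move=> gs le_k; apply: wp_seq.
pose Inv l k' s' := k + 8 * size l <= k' + (20 * n + 9) /\ 8 * size l <= k' /\
  forall x, x \notin l -> s' DOM (num x) = s OUT (num x).
apply: (@wp_nodes _ _ _ _ (k - 12 * n - 9) _ Inv) => //.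
- by lia.
- by rewrite /Inv size_nodes; split; [lia | split; [lia | move=> x; rewrite mem_nodes]].
- move=> x l k' s' agr sI _ [le1 [le2 inv]]; rewrite /= in le1 le2.
  apply: wp_put => /=; first by lia.
  split; first by lia.
  split; first by lia.
  move=> y yl; rewrite sI update_num; have [->|neq] := eqVneq y x; first by rewrite agr.
  by apply: inv; rewrite inE negb_or neq.
move=> k1 s1 agr1 [le1 [_ inv1]]; rewrite /= in le1.
have gs1 : graph s1 by apply: (graph_agree agr1).
set A := arr s Y; set O := arr s OUT.
have O1 : arr s1 DOM = O by apply/setP => x; rewrite !inE inv1.
have A1 x : (s1 Y (num x) != 0) = (x \in A) by rewrite inE agr1.
pose cost x := 20 + 30 * deg x.
have costE : \sum_(x <- nodes) cost x = 20 * n + 30 * sumdeg.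
  by rewrite sum_nodes big_split /= sum_nat_const mulnC -big_distrr.
pose done (l : seq T) s' := forall u w, u \in A -> u \notin l -> e u w -> w \notin A ->
  w \in arr s' DOM.
pose Inv1 l k' s' := k1 + \sum_(x <- l) cost x <= k' + (32 * n + 30 * sumdeg + 9) /\
  \sum_(x <- l) cost x <= k' /\
  [/\ O \subset arr s' DOM, arr s' DOM \subset O :|: nbr e A & done l s'].
apply: (@wp_nodes _ _ _ _ (k1 - 12 * n - 9) _ Inv1) => //.
- by lia.
- rewrite /Inv1 costE O1; split; first by lia.
  split; first by lia.
  by split; rewrite ?subsetUl // => u w _; rewrite mem_nodes.
- move=> x l k2 s2 agr2 sU _ [le2 [le2' [sub2 sup2 done2]]].
  rewrite !big_cons in le2 le2'; rewrite {1}/cost in le2; rewrite {1}/cost in le2'.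
  have gs2 : graph s2 by apply: (graph_agree agr2).
  apply: wp_if => /=; first by lia.
  rewrite sU agr2 // A1; case: ifP => xA; last first.
    apply: wp_skip; first by lia.
    split; first by lia.
    split; first by lia.
    split=> // u w uA ul; apply: done2 => //; rewrite inE negb_or ul andbT.
    by apply: contraTneq uA => ->; rewrite xA.
  pose Inv2 l' k' s' := k2 + 8 * size l' <= k' + (18 + 28 * deg x) /\ 8 * size l' <= k' /\
    [/\ arr s2 DOM \subset arr s' DOM, arr s' DOM \subset O :|: nbr e A
      & forall w, e x w -> w \notin l' -> w \notin A -> w \in arr s' DOM].
  apply: (@wp_nbr _ _ _ _ _ _ (k2 - 20 * deg x - 18) _ x Inv2) => //.
  + by lia.
  + rewrite /Inv2 size_adj; split; first by lia.
    split; first by lia.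
    by split=> // w exw; rewrite mem_adj exw.
  + move=> w l' k3 s3 agr3 sw exw _ [le3 [le3' [sub3 sup3 done3]]]; rewrite /= in le3 le3'.
    apply: wp_if => /=; first by lia.
    rewrite sw agr3 // agr2 // A1; case: ifP => wA.
      apply: wp_skip; first by lia.
      split; first by lia.
      split; first by lia.
      split=> // y exy yl yA; apply: done3 => //; rewrite inE negb_or yl andbT.
      by apply: contraNneq yA => ->.
    apply: wp_put => /=; first by lia.
    rewrite sw; split; first by lia.
    split; first by lia.
    rewrite arr_insert; split.
    * exact: subset_trans sub3 (subsetUr _ _).
    * rewrite subUset sup3 andbT sub1set in_setU; apply/orP; right.
      by rewrite /nbr in_set wA; apply/exists_inP; exists x.
    * move=> y exy yl yA; rewrite in_setU1; have [//|neq] := eqVneq y w.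
      by apply: done3; rewrite // inE negb_or neq.
  move=> k3 s3 _ [le3 [_ [sub3 sup3 done3]]]; rewrite /= in le3.
  split; first by lia.
  split; first by lia.
  split=> //; first exact: subset_trans sub3.
  move=> u w uA ul euw wA; have [def_u|neq] := eqVneq u x.
    by apply: done3; rewrite -?def_u.
  by apply: (subsetP sub3); apply: (done2 u) => //; rewrite inE negb_or neq.
move=> k2 s2 _ [le2 [_ [sub2 sup2 done2]]]; rewrite big_nil in le2.
split; first by lia.
apply/eqP; rewrite eqEsubset sup2 subUset sub2; apply/subsetP => w.
by rewrite /nbr in_set => /andP[wA /exists_inP[u uA euw]]; apply: (done2 u).
Qed.

Lemma wp_test k s : graph s -> 30 * n + 20 <= k ->
  wp test_strong (fun k' s' => k <= k' + (30 * n + 20) /\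
    (s' BAD 0 != 0) = ~~ (arr s Y \subset arr s P)) k s.
Proof.
move=> gs le_k; apply: wp_seq; apply: wp_put => /=; first by lia.
set s1 := update _ _ _ _; set A := arr s Y; set B := arr s P.
pose Inv l k' s' := k + 15 * size l <= k' + (27 * n + 12) /\ 15 * size l <= k' /\
  (s' BAD 0 = 0 -> forall u, u \notin l -> u \in A -> u \in B) /\
  (s' BAD 0 != 0 -> ~~ (A \subset B)).
have gs1 : graph s1 by case: gs.
apply: (@wp_nodes _ _ _ _ (k - 12 * n - 12) _ Inv) => //.
- by lia.
- rewrite /Inv size_nodes; split; first by lia.
  split; first by lia.
  by split=> // _ u; rewrite mem_nodes.
- move=> x l k2 s2 agr2 sU _ [le2 [le2' [inv0 inv1]]]; rewrite /= in le2 le2'.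
  have A2 : (s2 Y (num x) != 0) = (x \in A) by rewrite inE agr2.
  have B2 : (s2 P (num x) != 0) = (x \in B) by rewrite inE agr2.
  have keep : (x \in A) ==> (x \in B) ->
      (s2 BAD 0 = 0 -> forall u, u \notin l -> u \in A -> u \in B) /\
      (s2 BAD 0 != 0 -> ~~ (A \subset B)).
    move=> xAB; split=> // b0 u ul uA; have [eq_u|neq] := eqVneq u x.
      by move: xAB; rewrite -eq_u uA.
    by apply: inv0; rewrite // inE negb_or neq.
  apply: wp_if => /=; first by lia.
  rewrite sU A2; case: ifP => xA; last first.
    apply: wp_skip; first by lia.
    split; first by lia.
    split; first by lia.
    by apply: keep; rewrite xA.
  apply: wp_if => /=; first by lia.
  rewrite sU B2; case: ifP => xB.
    apply: wp_skip; first by lia.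
    split; first by lia.
    split; first by lia.
    by apply: keep; rewrite xB implybT.
  apply: wp_put => /=; first by lia.
  split; first by lia.
  split; first by lia.
  by split=> // _; apply/subsetPn; exists x; rewrite ?xB.
move=> k2 s2 _ [le2 [_ [inv0 inv1]]]; rewrite /= in le2.
split; first by lia.
apply/idP/idP => // nsub; apply: contraNneq nsub => b0.
by apply/subsetP => u uA; apply: inv0.
Qed.

(** * Parents and subtrees along the search order *)

Definition par x := odflt r [pick y | child y x].

(** The default in [par] reproduces the convention of the program, where the root is its own
    parent. *)
Lemma par_root : par r = r.
Proof.
by rewrite /par; case: pickP => //= y /child_dist; rewrite dist_root.
Qed.

Lemma par_child x : x != r -> child (par x) x.
Proof.
move=> x_r; rewrite /par; case: pickP => //= none.
by have [y] := exists_parent tree x_r; rewrite none.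
Qed.

Lemma par_unique x y : child y x -> par x = y.
Proof.
move=> yx; have x_r : x != r by rewrite -(dist_eq0 r tree) (child_dist yx).
exact: parent_unique (par_child x_r) yx.
Qed.

Definition by_dist : rel T := [rel x y | dist x <= dist y].

Lemma by_dist_trans : transitive by_dist.
Proof. by move=> y x z; apply: leq_trans. Qed.

Definition ordered (ord : seq T) s :=
  [/\ perm_eq ord (enum T), sorted by_dist ord,
      forall i, i < n -> s ORD i = num (nth r ord i)
    & forall x, s PAR (num x) = num (par x)].

Lemma ordered_agree (wr : name -> bool) ord s s' : agree wr s s' ->
  ~~ wr ORD -> ~~ wr PAR -> ordered ord s -> ordered ord s'.
Proof.
move=> agr wO wP [pe so oE pE]; split=> // [i lt_i|x]; rewrite agr //; exact: oE.
Qed.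

(** One pass along [ord] suffices: the parent of a node other than [r] is strictly closer to the
    root, hence comes earlier and already has its final mark. *)
Lemma wp_subtree ord v k s : graph s -> ordered ord s -> s V 0 = num v ->
  60 * n + 40 <= k ->
  wp compute_subtree (fun k' s' => k <= k' + (60 * n + 40) /\
    arr s' Y = subtree e r v) k s.
Proof.
move=> gs os sV le_k; apply: wp_seq.
pose Inv l k' s' := k + 6 * size l <= k' + (18 * n + 9) /\ 6 * size l <= k' /\
  forall x, x \notin l -> s' Y (num x) = 0.
apply: (@wp_nodes _ _ _ _ (k - 12 * n - 9) _ Inv) => //.
- by lia.
- by rewrite /Inv size_nodes; split; [lia | split; [lia | move=> x; rewrite mem_nodes]].
- move=> x l k' s' agr sI _ [le1 [le2 inv]]; rewrite /= in le1 le2.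
  apply: wp_put => /=; first by lia.
  split; first by lia.
  split; first by lia.
  move=> y yl; rewrite sI update_num; have [//|neq] := eqVneq y x.
  by apply: inv; rewrite inE negb_or neq.
move=> k1 s1 agr1 [le1 [_ inv1]]; rewrite /= in le1.
have gs1 : graph s1 by apply: (graph_agree agr1).
have [pe so oE pE] : ordered ord s1 by apply: (ordered_agree agr1).
have size_ord : size ord = n by rewrite (perm_size pe) -cardE.
have uo : uniq ord by rewrite (perm_uniq pe) enum_uniq.
apply: wp_seq; apply: wp_put => /=; first by lia.
have -> : s1 V 0 = num v by rewrite agr1.
set s2 := update _ _ _ _.
pose Inv2 l k' s' := k1 + 16 * size l <= k' + (28 * n + 20) /\ 16 * size l <= k' /\
  (exists p, ord = p ++ l) /\
  forall x, (s' Y (num x) != 0) = if x \in l then x == v else x \in subtree e r v.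
have map_ord : map (nth r ord) (index_iota 0 n) = ord.
  by rewrite /index_iota subn0 -size_ord -/(mkseq _ _) mkseq_nth.
apply: (@wp_for _ (nth r ord) _ _ _ _ _ _ (k1 - 12 * n - 13) _ n Inv2) => //=.
- by move=> s' /(_ N isT 0) ->; case: gs1.
- by rewrite subn0; lia.
- rewrite map_ord /Inv2 size_ord; split; first by lia.
  split; first by lia.
  split; first by exists [::].
  move=> x; have -> : x \in ord by rewrite (perm_mem pe) mem_enum.
  by rewrite /s2 update_num inv1 //; case: (x == v).
- move=> j k3 s3 lt_j agr3 sI; move: (map _ _) => l.
  case=> [le3 [le3' [[p def_ord] inv3]]]; rewrite /= in le3 le3'.
  set u := nth r ord j in def_ord inv3.
  apply: wp_seq; apply: wp_put => /=; first by lia.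
  have -> : s3 ORD (s3 I 0) = num u by rewrite sI agr3 // -oE.
  have par3 : s3 PAR (num u) = num (par u) by rewrite agr3 // -pE.
  set s4 := update s3 U 0 (num u).
  have Y4 x : (s4 Y (num x) != 0) = if x \in u :: l then x == v else x \in subtree e r v by apply: inv3.
  have PAR4 : s4 PAR (num u) = num (par u) := par3.
  have [ul_u /allP ul_le] : uniq (u :: l) /\ all (by_dist u) l.
    split; first by move: uo; rewrite def_ord cat_uniq => /and3P[].
    have: sorted by_dist (u :: l).
      by apply: (subseq_sorted by_dist_trans (suffix_subseq p _)); rewrite -def_ord.
    by rewrite /= (path_sortedE by_dist_trans) => /andP[].
  have sub_u : (u \in subtree e r v) = (s4 Y (num (par u)) != 0) || (u == v).
    (* At the root the program reads the root's own mark, which is still the initial one; this is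
       right because [r] lies in the subtree of [v] only if [v = r]. *)
    rewrite Y4; have [eq_r|neq_r] := eqVneq u r.
      have -> : par u = u by rewrite eq_r par_root.
      rewrite mem_head orbb eq_r.
      apply/idP/eqP => [/subtree_dist|->]; last exact: subtree_refl.
      by rewrite (dist_root r tree) leqn0 (dist_eq0 r tree) => /eqP.
    have ch := par_child neq_r.
    rewrite (subtree_parent tree v ch) orbC; case: ifP => // par_l.
    have: dist u <= dist (par u).
      by move: par_l; rewrite inE => /predU1P[->//|/ul_le].
    by rewrite (child_dist ch) ltnn.
  have u_l : u \notin l by case/andP: ul_u.
  have fin s5 k5 : k1 + 16 * size l <= k5 + (28 * n + 20) -> 16 * size l <= k5 ->
      (forall x, x != u -> s5 Y (num x) = s4 Y (num x)) ->
      (s5 Y (num u) != 0) = (u \in subtree e r v) -> Inv2 l k5 s5.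
    move=> h1 h2 other at_u; split=> //; split=> //; split; first by exists (rcons p u); rewrite cat_rcons.
    move=> x; have [->|neq] := eqVneq x u; first by rewrite (negPf u_l).
    by rewrite other // Y4 inE (negPf neq).
  apply: wp_if => /=; first by lia.
  have -> : s4 U 0 = num u by [].
  rewrite PAR4; case: ifP => par_Y.
    apply: wp_put => /=; first by lia.
    apply: fin; try by lia.
      by move=> x neq; rewrite update_num (negPf neq).
    by rewrite update_num eqxx sub_u par_Y.
  apply: wp_skip; first by lia.
  by apply: fin => //; try lia; rewrite sub_u par_Y Y4 mem_head.
move=> k3 s3 _ [le3 [_ [_ inv3]]]; rewrite /= in le3.
split; first by lia.
by apply/setP => x; rewrite inE inv3.
Qed.

(** * Breadth-first search *)

Definition visited (a q : seq T) s :=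
  [/\ [/\ s TL 0 = size q, forall i, i < size q -> s ORD i = num (nth r q i) & uniq q],
      forall x, (s SEEN (num x) != 0) = (x \in q), r \in q, sorted by_dist q
    & forall x, x \in q -> s PAR (num x) = num (par x) /\ (x != r -> par x \in a)].

(** The last clause of [visited] serves here: if [w] were the parent of [u], it would be among the
    explored nodes [a] and thus in [q]. *)
Lemma visited_child (a q : seq T) u w s : visited a q s -> {subset a <= q} ->
  u \in q -> e u w -> w \notin q -> child u w.
Proof.
move=> [_ _ rq _ parq] sub uq euw wq; case/orP: (edge_child r tree euw) => // wu.
have u_r : u != r by rewrite -(dist_eq0 r tree) (child_dist wu).
have [_ /(_ u_r)/sub] := parq u uq.
by rewrite (par_unique wu) (negPf wq).
Qed.

(** No discovered node lies deeper than one level below [u], and new nodes are children of [u] on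
    exactly that level, so appending them keeps the list sorted. *)
Lemma wp_explore a b u k s : graph s -> visited a (a ++ u :: b) s ->
  s U 0 = num u -> {in a ++ u :: b, forall x, dist x <= (dist u).+1} ->
  14 + 50 * deg u <= k ->
  wp (for_nbr K W U
       (If (Get SEEN (Get W (Num 0))) Skip
          (Put SEEN (Get W (Num 0)) (Num 1);;
           Put PAR (Get W (Num 0)) (Get U (Num 0));;
           Put ORD (Get TL (Num 0)) (Get W (Num 0));;
           incr TL)))
    (fun k' s' => k <= k' + (14 + 50 * deg u) /\
       exists b', [/\ visited (rcons a u) (a ++ u :: b ++ b') s',
         {in a ++ u :: b ++ b', forall x, dist x <= (dist u).+1}
         & forall w, e u w -> w \in a ++ u :: b ++ b']) k s.
Proof.
move=> gs vis sU le_u le_k.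
pose Inv l k' s' := k + 30 * size l <= k' + (14 + 50 * deg u) /\ 30 * size l <= k' /\
  exists b', [/\ visited (rcons a u) (a ++ u :: b ++ b') s',
         {in a ++ u :: b ++ b', forall x, dist x <= (dist u).+1}
         & forall w, e u w -> w \notin l -> w \in a ++ u :: b ++ b'].
apply: (@wp_nbr _ _ _ _ _ _ (k - 20 * deg u - 14) _ u Inv) => //.
- by lia.
- rewrite /Inv size_adj; split; first by lia.
  split; first by lia.
  exists [::]; rewrite cats0; split=> // [|w euw]; last by rewrite mem_adj euw.
  case: vis => ? ? ? ? parq; split=> // x /parq[-> in_a]; split=> // /in_a xa.
  by rewrite mem_rcons inE xa orbT.
- move=> w l k1 s1 agr1 sw euw uwl [le1 [le1' [b' [vis1 leq1 cov1]]]].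
  rewrite /= in le1 le1'; set q := a ++ u :: b ++ b' in vis1 leq1 cov1.
  have [[tl1 ord1 uq1] seen1 rq so1 par1] := vis1.
  have uq : u \in q by rewrite /q mem_cat mem_head orbT.
  apply: wp_if => /=; first by lia.
  rewrite sw seen1; case: ifP => wq.
    apply: wp_skip; first by lia.
    split; first by lia.
    split; first by lia.
    exists b'; split=> // v euv vl; have [->//|neq] := eqVneq v w.
    by apply: cov1; rewrite // inE negb_or neq.
  have ch : child u w.
    apply: (visited_child vis1) => //; last by rewrite wq.
    by move=> x; rewrite /q mem_rcons mem_cat !inE => /orP[]->; rewrite ?orbT.
  apply: wp_seq; apply: wp_put => /=; first by lia.
  apply: wp_seq; apply: wp_put => /=; first by lia.
  apply: wp_seq; apply: wp_put => /=; first by lia.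
  apply: wp_put => /=; first by lia.
  split; first by lia.
  split; first by lia.
  have qE : a ++ u :: b ++ rcons b' w = rcons q w by rewrite /q rcons_cat rcons_cons rcons_cat.
  exists (rcons b' w); rewrite qE; split; last first.
  + move=> v euv vl; rewrite mem_rcons inE; have [//|neq] := eqVneq v w.
    by apply: cov1; rewrite // inE negb_or neq.
  + by move=> x; rewrite mem_rcons inE => /predU1P[->|/leq1//]; rewrite (child_dist ch).
  have sU1 : s1 U 0 = num u by rewrite agr1.
  rewrite /update /= sw sU1 tl1; split.
  + split; first by rewrite size_rcons addn1.
      move=> i; rewrite size_rcons nth_rcons ltnS leq_eqVlt.
      by case: eqP => [-> _|/= _ lt_i]; rewrite ?ltnn ?eqxx // lt_i ord1.
    by rewrite rcons_uniq wq.
  + by move=> x; rewrite mem_rcons inE -seen1 (inj_eq num_inj); case: (x == w).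
  + by rewrite mem_rcons inE rq orbT.
  + rewrite (sorted_pairwise by_dist_trans) pairwise_rcons -(sorted_pairwise by_dist_trans) so1 andbT.
    by apply/allP => x /leq1; rewrite /= -(child_dist ch).
  + move=> x; rewrite mem_rcons inE (inj_eq num_inj); have [-> _|neq /= /par1 //] := eqVneq x w.
    by rewrite (par_unique ch) mem_rcons mem_head.
move=> k' s' _ [le1 [_ [b' [vis1 leq1 cov1]]]]; rewrite /= in le1.
split; first by lia.
by exists b'; split=> // w euw; apply: cov1.
Qed.

Lemma reachable_all (a : seq T) : r \in a ->
  (forall x y, x \in a -> e x y -> y \in a) -> forall x, x \in a.
Proof.
move=> ra clo x; have [_ /(_ r x)/connectP[p e_p ->] _] := tree.
elim: p r ra e_p => //= y p IH z za /andP[ezy e_p]; apply: IH e_p; exact: clo ezy.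
Qed.

Lemma wp_bfs k s : graph s -> s ROOT 0 = num r -> 70 * n + 50 * sumdeg + 60 <= k ->
  wp bfs (fun k' s' => k <= k' + (70 * n + 50 * sumdeg + 60) /\
    exists ord, ordered ord s') k s.
Proof.
move=> gs sR le_k; apply: wp_seq.
pose Inv l k' s' := k + 6 * size l <= k' + (18 * n + 9) /\ 6 * size l <= k' /\
  forall x, x \notin l -> s' SEEN (num x) = 0.
apply: (@wp_nodes _ _ _ _ (k - 12 * n - 9) _ Inv) => //.
- by lia.
- by rewrite /Inv size_nodes; split; [lia | split; [lia | move=> x; rewrite mem_nodes]].
- move=> x l k' s' agr sI _ [le1 [le2 inv]]; rewrite /= in le1 le2.
  apply: wp_put => /=; first by lia.
  split; first by lia.
  split; first by lia.
  move=> y yl; rewrite sI update_num; have [//|neq] := eqVneq y x.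
  by apply: inv; rewrite inE negb_or neq.
move=> k1 s1 agr1 [le1 [_ inv1]]; rewrite /= in le1.
have gs1 : graph s1 by apply: (graph_agree agr1).
have sR1 : s1 ROOT 0 = num r by rewrite agr1.
do 5 (apply: wp_seq; apply: wp_put => /=; first by lia).
set s2 := update _ TL _ _.
have gs2 : graph s2 by case: gs1.
have vis2 : visited [::] [:: r] s2.
  rewrite /s2 /update /= sR1; split=> //.
  - by split=> // -[].
  - move=> x; rewrite inE (inj_eq num_inj); case: (x == r) => //; by rewrite inv1.
  - exact: mem_head.
  - move=> x; by rewrite inE => /eqP->; rewrite par_root !eqxx; split.
pose cost x := 40 + 50 * deg x.
have costE : \sum_x cost x = 40 * n + 50 * sumdeg.
  by rewrite big_split /= sum_nat_const mulnC -big_distrr.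
pose Inv2 k' s' := exists a b, [/\ s' HD 0 = size a, visited a (a ++ b) s',
  forall x y, x \in a -> e x y -> y \in a ++ b,
  forall x y, x \in a ++ b -> y \in b -> dist x <= (dist y).+1
  & k1 + \sum_(x | x \notin a) cost x <= k' + (40 * n + 50 * sumdeg + 19) /\
    \sum_(x | x \notin a) cost x + 10 <= k'].
apply: (@wp_while _ _ _ _ _ Inv2).
  exists [::], [:: r]; split=> //; first by move=> x y; rewrite !inE => /eqP-> /eqP->.
  have -> : \sum_(x | x \notin [::]) cost x = 40 * n + 50 * sumdeg by rewrite -costE; apply: eq_bigl.
  by split; lia.
move=> k3 s3 agr3 [a [b [hd3 vis3 clo3 dist3 [le3 le3']]]].
have gs3 : graph s3 by apply: (graph_agree agr3).
have [[tl3 ord3 uq3] seen3 rq3 so3 par3] := vis3.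
split; first by rewrite /=; lia.
rewrite /= hd3 tl3 size_cat -[X in X < _]addn0 ltn_add2l.
case: b => [|u b] /= in vis3 clo3 dist3 tl3 ord3 uq3 seen3 rq3 so3 par3 *.
  rewrite cats0 in vis3 clo3 dist3 tl3 ord3 uq3 seen3 rq3 so3 par3.
  exists (k3 - 6); first by lia.
  split; first by lia.
  have all_a : forall x, x \in a by apply: reachable_all.
  have perm_a : perm_eq a (enum T).
    by apply: uniq_perm; rewrite ?enum_uniq // => x; rewrite mem_enum all_a.
  exists a; split=> // [i lt_i|x]; last by case: (par3 x).
  by apply: ord3; rewrite (perm_size perm_a) -cardE.
have ua : u \notin a.
  by move: uq3; rewrite cat_uniq /= => /and3P[_ /norP[]].
rewrite (sum_notin_rcons _ ua) in le3 le3'; rewrite {1}/cost in le3; rewrite {1}/cost in le3'.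
apply: wp_seq; apply: wp_put => /=; first by lia.
apply: wp_seq; apply: wp_put => /=; first by lia.
set s5 := update _ HD _ _.
apply: (wp_conseq (@wp_explore a b u _ s5 _ _ _ _ _)) => //.
- by rewrite /s5 /update /= hd3 ord3 ?nth_cat ?ltnn ?subnn // size_cat /= -[X in X < _]addn0 ltn_add2l.
- by move=> x xq; apply: dist3 => //; rewrite mem_head.
- by lia.
move=> k6 s6 agr6 [le6 [b' [vis6 leq6 cov6]]].
exists (rcons a u), (b ++ b'); rewrite cat_rcons; split=> //.
- by rewrite agr6 // size_rcons /s5 /update /= hd3 addn1.
- move=> x y; rewrite mem_rcons inE => /predU1P[->|xa exy]; first exact: cov6.
  have := clo3 x y xa exy; rewrite !mem_cat !inE mem_cat => /or3P[]->; by rewrite ?orbT.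
(* Every node waiting after [u] is at least as deep as [u], so the depth bound known for [u] holds
   for it too. *)
- move=> x y xq yb; apply: leq_trans (leq6 x xq) _; rewrite ltnS.
  have [_ _ _ so6 _] := vis6.
  have: sorted by_dist (u :: b ++ b').
    by apply: (subseq_sorted by_dist_trans (suffix_subseq a _)).
  by rewrite /= (path_sortedE by_dist_trans) => /andP[/allP/(_ y yb)].
- by split; lia.
Qed.

(** * The whole program and its cost *)

Lemma level_order_rev ord s : ordered ord s -> level_order e r (rev ord).
Proof.
case=> pe so _ _; rewrite /level_order rev_sorted (perm_trans _ pe) //=.
by rewrite perm_rev.
Qed.

(** Subtree, boundary, closure and test together take [340 * n + 230 * sumdeg + 180]; the rest
    absorbs the control steps. *)
Definition round_cost := 400 * n + 300 * sumdeg + 300.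
Definition total_cost := (n * round_cost + 120 * n + 50 * sumdeg + 200).

Lemma wp_greedy_program k s : graph s -> s ROOT 0 = num r -> total_cost <= k ->
  wp greedy_program (fun k' s' => exists ord,
    level_order e r ord /\ output num s' = greedy e r ord) k s.
Proof.
move=> gs sR le_k; rewrite /total_cost in le_k; apply: wp_seq.
pose Inv l k' s' := k + 6 * size l <= k' + (18 * n + 9) /\ 6 * size l <= k' /\
  forall x, x \notin l -> s' OUT (num x) = 0.
apply: (@wp_nodes _ _ _ _ (k - 12 * n - 9) _ Inv) => //.
- by lia.
- by rewrite /Inv size_nodes; split; [lia | split; [lia | move=> x; rewrite mem_nodes]].
- move=> x l k' s' agr sI _ [le1 [le2 inv]]; rewrite /= in le1 le2.
  apply: wp_put => /=; first by lia.
  split; first by lia.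
  split; first by lia.
  move=> y yl; rewrite sI update_num; have [//|neq] := eqVneq y x.
  by apply: inv; rewrite inE negb_or neq.
move=> k1 s1 agr1 [le1 [_ inv1]]; rewrite /= in le1.
have gs1 : graph s1 by apply: (graph_agree agr1).
have sR1 : s1 ROOT 0 = num r by rewrite agr1.
apply: wp_seq; apply: (wp_conseq (wp_bfs gs1 sR1 _)); first by lia.
move=> k2 s2 agr2 [le2 [ord os2]].
have gs2 : graph s2 by apply: (graph_agree agr2).
have out2 x : s2 OUT (num x) = 0 by rewrite agr2 ?inv1.
have [pe _ _ _] := os2.
have size_ord : size ord = n by rewrite (perm_size pe) -cardE.
apply: wp_seq; apply: wp_put => /=; first by lia.
set s3 := update _ _ _ _.
(* [ORD] is read from its end: [p] is still to come and [d] is done, so the nodes were processed in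
   the order [rev d]. *)
pose Inv2 k' s' := exists p d, [/\ ord = p ++ d, s' J 0 = size p, graph s',
  ordered ord s' & arr s' OUT = greedy e r (rev d) /\ size p * round_cost + 10 <= k'].
apply: (@wp_while _ _ _ _ _ Inv2).
  have [gN _ _] := gs2.
  exists ord, [::]; split=> //.
  - by rewrite cats0.
  - by rewrite /s3 /update /= gN size_ord.
  split; last by rewrite size_ord; lia.
  by apply/setP => x; rewrite !inE -[s3 OUT _]/(s2 OUT (num x)) out2.
move=> k4 s4 _ [p [d [def_ord sJ4 gs4 os4 [out4 le4]]]].
split; first by rewrite /=; lia.
rewrite /= sJ4; case/lastP: p => [|p v] in def_ord sJ4 le4 *.
  rewrite /= in def_ord; exists (k4 - 6); first by move: le4; rewrite /=; lia.
  exists (rev d); split; last exact: out4.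
  by rewrite -def_ord; apply: level_order_rev os4.
rewrite size_rcons /= in sJ4 le4 *; rewrite mulSn {1}/round_cost in le4.
apply: wp_seq; apply: wp_put => /=; first by lia.
apply: wp_seq; apply: wp_put => /=; first by lia.
set s5 := update _ V _ _.
have lt_p : size p < n by rewrite -size_ord def_ord size_cat size_rcons; lia.
have sJ5 : s5 J 0 = size p by rewrite /s5 /update /= sJ4 subn1.
have sV5 : s5 V 0 = num v.
  rewrite /s5 /update /= sJ4 subn1 /=; have [_ _ -> //] := os4.
  by rewrite def_ord nth_cat size_rcons ltnSn nth_rcons ltnn eqxx.
have gs5 : graph s5 by case: gs4.
have os5 : ordered ord s5 by case: os4.
apply: wp_seq; apply: (wp_conseq (wp_subtree gs5 os5 sV5 _)); first by lia.
move=> k6 s6 agr6 [le6 Y6].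
have gs6 : graph s6 by apply: (graph_agree agr6).
apply: wp_seq; apply: (wp_conseq (wp_dom gs6 _)); first by lia.
move=> k7 s7 agr7 [le7 D7].
have gs7 : graph s7 by apply: (graph_agree agr7).
apply: wp_seq; apply: (wp_conseq (wp_power_closure gs7 D7 _)); first by rewrite /closure_cost; lia.
rewrite /closure_cost => k8 s8 agr8 [le8 P8].
have gs8 : graph s8 by apply: (graph_agree agr8).
apply: wp_seq; apply: (wp_conseq (wp_test gs8 _)); first by lia.
move=> k9 s9 agr9 [le9 bad9].
have gs9 : graph s9 by apply: (graph_agree agr9).
have os9 : ordered ord s9.
  apply: (ordered_agree agr9) => //; apply: (ordered_agree agr8) => //.
  by apply: (ordered_agree agr7) => //; apply: (ordered_agree agr6).
have O6 : arr s6 OUT = arr s4 OUT by apply/setP => x; rewrite !inE agr6.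
have O9 : arr s9 OUT = arr s4 OUT.
  by apply/setP => x; rewrite !inE agr9 // agr8 // agr7 // agr6.
have Y8 : arr s8 Y = arr s6 Y by apply/setP => x; rewrite !inE agr8 // agr7.
have sJ9 : s9 J 0 = size p by rewrite agr9 // agr8 // agr7 // agr6.
have sV9 : s9 V 0 = num v by rewrite agr9 // agr8 // agr7 // agr6.
have bad : (s9 BAD 0 != 0) = strong_region e (greedy e r (rev d)) (subtree e r v).
  by rewrite bad9 P8 Y8 Y6 O6 out4.
have grE : greedy e r (rev (v :: d)) = greedy_step e r (greedy e r (rev d)) v.
  by rewrite rev_cons /greedy foldl_rcons.
apply: wp_if => /=; first by lia.
rewrite bad; case: ifP => str.
  apply: wp_put => /=; first by lia.
  exists p, (v :: d); rewrite grE /greedy_step str; split=> //.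
    by rewrite def_ord cat_rcons.
  by rewrite sV9 arr_insert O9 out4; split; last by lia.
apply: wp_skip; first by lia.
exists p, (v :: d); rewrite grE /greedy_step str; split=> //.
  by rewrite def_ord cat_rcons.
by rewrite O9 out4; split; last by lia.
Qed.

Lemma greedy_program_correct : exists (st' : store) (t : nat),
  [/\ exec greedy_program st st' t,
      exists ord, level_order e r ord /\ output num st' = greedy e r ord
    & t <= total_cost].
Proof.
have gst : graph st by case: enc.
have sR : st ROOT 0 = num r by case: enc.
have [st' [t [k' [ex le spec]]]] := wp_greedy_program gst sR (leqnn total_cost).
by exists st', t; split=> //; lia.
Qed.

Lemma sumdeg_le : sumdeg <= 2 * #|edges e|.
Proof.
rewrite /sumdeg.
have -> : \sum_x deg x = #|[set xy : T * T | e xy.1 xy.2]|.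
  rewrite -sum1_card (eq_bigl (fun xy : T * T => true && e xy.1 xy.2)); last by move=> xy; rewrite inE.
  rewrite -(pair_big_dep predT e (fun _ _ => 1)) /=.
  by apply: eq_bigr => x _; rewrite sum1_card.
(* Double counting: an edge is the image under [f] of at most two ordered pairs, as irreflexivity
   excludes pairs with equal entries. *)
pose f (xy : T * T) := [set xy.1; xy.2].
rewrite -sum1_card (partition_big f (mem (edges e))) /=; last first.
  move=> [x y]; rewrite !inE /= => exy; apply/existsP; exists x; apply/existsP; exists y.
  by rewrite exy eqxx.
rewrite mulnC -sum_nat_const; apply: leq_sum => E.
rewrite inE => /existsP[x /existsP[y /andP[_ /eqP defE]]].
rewrite sum1_card; apply: (@leq_trans #|[set (x, y); (y, x)]|); last first.
  by rewrite cards2; case: (_ != _).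
apply/subset_leq_card/subsetP => -[a b]; rewrite !inE /= => /andP[eab /eqP defE'].
have aE : a \in [set x; y] by rewrite -defE -defE' set21.
have bE : b \in [set x; y] by rewrite -defE -defE' set22.
have neq : a != b.
  by apply/eqP => eq_ab; move: eab; rewrite eq_ab inE (tree_irr tree).
move: aE bE neq; rewrite !inE !xpair_eqE.
by do 2 (case/orP => /eqP->); rewrite ?eqxx ?orbT.
Qed.

(** The first step of a path to another node is an edge at [x]. With a single node there is no edge,
    and a bound by a multiple of the number of edges would be zero. *)
Lemma deg_gt0 x : 1 < n -> 0 < deg x.
Proof.
move=> n1; have /card_gt1P[a [b [_ _ neq]]] : 1 < #|T| by [].
have [z neq_z] : exists z, x != z.
  have [eq_x|] := eqVneq x a; last by exists a.
  by exists b; rewrite eq_x.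
have [_ /(_ x z)/connectP[[|y p] /= e_p def_z] _] := tree.
  by rewrite def_z eqxx in neq_z.
by case/andP: e_p => exy _; apply/card_gt0P; exists y.
Qed.

Lemma order_le : 1 < n -> n <= sumdeg.
Proof.
move=> n1; rewrite /sumdeg /nb_nodes -sum1_card; apply: leq_sum => x _; exact: deg_gt0.
Qed.
End Program.

Theorem theorem5 :
  (forall (T : finType) (e : rel T) (r : T) (s : seq T),
     is_tree e -> level_order e r s ->
     minimum_power_dominating e (greedy e r s)) /\
  (exists C : nat,
     forall (T : finType) (e : rel T) (r : T) (num : T -> nat) (st : store),
       is_tree e -> encodes e r num st ->
       exists (st' : store) (t : nat),
         [/\ exec greedy_program st st' t,
             (exists s : seq T,
                level_order e r s /\ output num st' = greedy e r s)
           & 1 < #|T| -> t <= C * (#|T| * #|edges e|)]).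
Proof.
split=> [T e r s tree level|]; first exact: greedy_minimum.
(* With [n <= d <= 2 * m] and [0 < m], the rounds cost at most 1700 times [n * m]; the terms
   [120 * n], [50 * d] and 200 add at most 120, 100 and 200 times [n * m]. The sum is rounded up. *)
exists 2200 => T e r num st tree enc.
have [st' [t [ex spec le_t]]] := greedy_program_correct tree enc.
exists st', t; split=> //; rewrite -[#|T|]/(nb_nodes T) => n1.
have := order_le tree n1; have := sumdeg_le tree.
move: le_t; rewrite /total_cost /round_cost.
move: (nb_nodes T) (sumdeg e) #|edges e| n1 => n d m n1 le_t le_d le_n.
have m0 : 0 < m by lia.
have : n * (400 * n + 300 * d + 300) <= 1700 * (n * m).
  by rewrite mulnCA leq_mul2l; apply/orP; right; lia.
have : n <= n * m by apply: leq_pmulr.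
have : m <= n * m by apply: leq_pmull; apply: ltnW.
by lia.
Qed.
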